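(* Let $p\ge2$, $n=p(p-1)/2$, $1\le s\le p-1$, $k\ge1$ with $N(p,s)>k$, $m>0$, $\mu>0$, $\varepsilon\in(0,1)$, and let $\mathcal{C}'$ denote the class of unions of $k$ or $k-1$ pairwise disjoint $s$-stars of the complete graph on $p$ vertices. Suppose there are an adaptive sensing procedure satisfying the precision budget $\mathbb{E}_S\big(\sum_j\Gamma_j\big)\le m$ for every $S\in\mathcal{C}'$ and an estimator $\hat S$ such that $\max_{S\in\mathcal{C}'}\mathbb{E}_S(|\hat S\triangle S|)\le\varepsilon$. Then necessarily $$\mu \geq \sqrt{\frac{2(N(p,s) -k)}{m} \left( \log k + \log \frac{N(p,s)-k}{N(p,s)+1} + \log \frac{s}{8\varepsilon}\right)}$$ (the bound being void if the expression under the square root is negative).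
   Context: The coordinates $\{1,\dots,n\}$, $n=p(p-1)/2$, are identified with the edges of the complete undirected graph on $p$ vertices. An $s$-star is a set of $s$ edges all sharing a common vertex. Stars are disjoint when they have no edge in common. $N(p,s)$ is the maximal number of pairwise disjoint $s$-stars in the complete graph on $p$ vertices. The union of $0$ stars is the empty set. Sensing model. For an unknown support set $S\subseteq\{1,\dots,n\}$ and $\mu>0$, the signal $\boldsymbol{x}\in\mathbb{R}^n$ has $x_i=\mu$ if $i\in S$ and $x_i=0$ otherwise. One collects measurements $Y_j=x_{A_j}+\Gamma_j^{-1/2}W_j$, $j=1,2,\dots$, where $A_j\in\{1,\dots,n\}$ is the measured coordinate, $\Gamma_j>0$ is the precision, and the $W_j$ are i.i.d. $\mathcal{N}(0,1)$, with $W_j$ independent of $\{A_i,\Gamma_i\}_{i\le j}$ and of the past observations. An adaptive sensing procedure chooses $(A_j,\Gamma_j)$ as a (possibly randomized) function of $\{Y_i,A_i,\Gamma_i\}_{i<j}$, and may stop at a data-dependent time (sums over $j$ run over the measurements actually made). An estimator $\hat S\subseteq\{1,\dots,n\}$ is a function of all collected data. $\mathbb{P}_S,\mathbb{E}_S$ denote probability and expectation when the support is $S$. $\triangle$ is symmetric difference. *)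

(* Defs.v *)
From HB Require Import structures.
From mathcomp Require Import all_boot all_order all_algebra.
From mathcomp Require Import all_classical all_reals all_analysis.
Import Order.TTheory GRing.Theory Num.Theory.
Import numFieldNormedType.Exports.

Set Implicit Arguments.
Unset Strict Implicit.
Unset Printing Implicit Defensive.

Local Open Scope classical_set_scope.
Local Open Scope ring_scope.

Definition edge (p : nat) : finType := {e : {set 'I_p} | #|e| == 2%N}.

Lemma card_edge (p : nat) : #|edge p| = (p * p.-1)./2.
Proof.
have -> : #|edge p| = #|[set e : {set 'I_p} | #|e| == 2%N]%SET|.
  by rewrite card_sig; apply: eq_card => e; rewrite !inE.
by rewrite card_draws card_ord bin2.
Qed.

Definition is_star (p s : nat) (A : {set edge p}) : bool :=
  (#|A| == s) && [exists v : 'I_p, [forall e in A, v \in val e]].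

(* For s >= 1 disjoint s-stars are distinct, so a family of pairwise disjoint
   s-stars is the same thing as a set of them. *)
Definition star_packing (p s : nat) (F : {set {set edge p}}) : bool :=
  [forall A in F, is_star s A] &&
  [forall A in F, forall B in F, (A != B) ==> [disjoint A & B]].

Definition max_stars (p s : nat) : nat :=
  \max_(F : {set {set edge p}} | star_packing s F) #|F|.

Definition star_unions (p s k : nat) : {set {set edge p}} :=
  [set S | [exists F : {set {set edge p}},
    [&& star_packing s F, (#|F| == k) || (#|F| == k.-1) & S == finset.cover F]]]%SET.

(* [None] means that sensing has stopped; [Some (i, v)] carries the value [v]
   attached to coordinate [i].  The sigma-algebra is that of the disjoint union
   of a point and of one copy of [V] for every [i : E]. *)
Definition slot (E : finType) (V : Type) : Type := option (E * V).

Definition slot_display : measure_display -> measure_display.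
Proof. exact. Qed.

Section slot_measurable.
Context (E : finType) (d : measure_display) (V : measurableType d).

HB.instance Definition _ := Choice.on (slot E V).
HB.instance Definition _ := isPointed.Build (slot E V) None.

Let slot_set (A : set (slot E V)) : Prop :=
  forall i : E, measurable [set v : V | A (Some (i, v))].

Let slot_set0 : slot_set set0.
Proof. by move=> i; exact: measurable0. Qed.

Let slot_setC A : slot_set A -> slot_set (~` A).
Proof. by move=> mA i; exact: measurableC (mA i). Qed.

Let slot_bigcup (F : (set (slot E V))^nat) :
  (forall n, slot_set (F n)) -> slot_set (\bigcup_n F n).
Proof.
move=> mF i.
rewrite (_ : [set v | _] = \bigcup_n [set v | F n (Some (i, v))]) //.
by apply: bigcupT_measurable => n; exact: mF.
Qed.

HB.instance Definition _ := @isMeasurable.Build (slot_display d) (slot E V)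
  slot_set slot_set0 slot_setC slot_bigcup.

End slot_measurable.

Section sensing.
Context (R : realType) (E : finType).

(* A decision is to stop or to measure a coordinate with a given precision;
   a record consists of the coordinate, the precision and the observation. *)
Definition decision := slot E R.
Definition record := slot E (R * R)%type.

HB.instance Definition _ := Measurable.on decision.
HB.instance Definition _ := Measurable.on record.

(* A randomized function of the past is a probability kernel. *)
Record procedure := Procedure {
  rule : forall j : nat, R.-pker (j.-tuple record) ~> decision;
  rule_precision_gt0 : forall j (h : j.-tuple record),
    rule j h [set a | forall i g, a = Some (i, g) -> 0 < g] = 1%E;
  rule_stopped : forall j (h : j.-tuple record),
    None \in tval h -> rule j h [set None] = 1%E }.

Definition signal (mu : R) (S : {set E}) (i : E) : R :=
  if i \in S then mu else 0.

Definition measure_slot (x : E -> R) (a : decision) (w : R) : record :=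
  if a is Some (i, g) then Some (i, (g, x i + (Num.sqrt g)^-1 * w)) else None.

Definition precision (a : decision) : R := if a is Some (_, g) then g else 0.

Definition past (T : Type) (D : nat -> T -> record) (j : nat) (w : T) :
  j.-tuple record := [tuple D i w | i < j].

(* The probability space on which the procedure [proc] is run on the signal [x].
   The kernels of [proc] do not depend on [x].  After stopping, the remaining
   noise variables exist but are not observed. *)
Record experiment (x : E -> R) (proc : procedure) := Experiment {
  space_display : measure_display;
  space : measurableType space_display;
  law : probability space R;
  decide : nat -> space -> decision;
  noise : nat -> space -> R;
  data := fun j w => measure_slot x (decide j w) (noise j w);
  decide_precision_gt0 : forall j w i g, decide j w = Some (i, g) -> 0 < g;
  decide_stopped : forall j w, decide j w = None -> decide j.+1 w = None;
  measurable_decide : forall j, measurable_fun [set: space] (decide j);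
  measurable_noise : forall j, measurable_fun [set: space] (noise j);
  noise_normal : forall j (B : set R), measurable B ->
    law (noise j @^-1` B) = normal_prob 0 1 B;
  noise_mutually_independent : forall (J : seq nat) (B : nat -> set R),
    uniq J -> (forall j, measurable (B j)) ->
    law (\bigcap_(j in [set` J]) noise j @^-1` B j) =
    (\prod_(j <- J) law (noise j @^-1` B j))%E;
  noise_independent_past : forall j (B : set R)
      (C : set (j.-tuple record * decision)%type),
    measurable B -> measurable C ->
    law (noise j @^-1` B `&` [set w | C (past data j w, decide j w)]) =
    (law (noise j @^-1` B) * law [set w | C (past data j w, decide j w)])%E;
  decide_conditional_law : forall j (H : set (j.-tuple record))
      (C : set decision),
    measurable H -> measurable C ->
    law (past data j @^-1` H `&` decide j @^-1` C) =
    (\int[law]_(w in past data j @^-1` H) rule proc j (past data j w) C)%E }.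

Global Arguments decide {x proc} e j w.
Global Arguments noise {x proc} e j w.
Global Arguments data {x proc} e j w.

(* The sigma-algebra on sequences of records generated by the coordinates. *)
Definition data_measurable : set (set (nat -> record)) :=
  <<s [set C | exists j (B : set record),
         measurable B /\ C = [set r | B (r j)]] >>.

Record estimator := Estimator {
  estimate :> (nat -> record) -> {set E};
  measurable_estimate : forall Z : {set E},
    data_measurable [set r | estimate r = Z] }.

Definition expected_precision x proc (X : experiment x proc) : \bar R :=
  (\int[law X]_w \sum_(0 <= j <oo) (precision (decide X j w))%:E)%E.

Definition symdiff (A B : {set E}) : {set E} := (A :\: B) :|: (B :\: A).

Definition expected_error x proc (X : experiment x proc) (est : estimator)
    (S : {set E}) : \bar R :=
  (\int[law X]_w
     (#|symdiff (est (fun j => data X j w)) S|%:R : R)%:E)%E.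

End sensing.

(* Main.v *)
Require Import Defs.
From HB Require Import structures.
From mathcomp Require Import all_boot all_order all_algebra.
From mathcomp Require Import all_classical all_reals all_analysis measurable_realfun.
From mathcomp Require Import ring lra.
Import Order.TTheory GRing.Theory Num.Theory.
Import numFieldNormedType.Exports.

Set Implicit Arguments.
Unset Strict Implicit.
Unset Printing Implicit Defensive.

Local Open Scope classical_set_scope.
Local Open Scope ring_scope.

(** Compare the law P of the data on a union S of k - 1 stars with the law P' on
    the union of S and one further star A of the packing.  The log-likelihood
    ratio has mean D = mu^2/2 * (expected precision spent on A) under P, so the
    pointwise tangent inequality exp(-l) >= exp(-c) (1 + c - l) gives, for every
    event C and every c >= 0,
      P'(C) >= exp(-c) (c P(C) - D).
    This bound is linear in P, P' and D.  Apply it to the events "edge e is not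
    in the estimate", e in A, and sum over e, A and S: the risk under P keeps
    P(C) close to 1 on average, the stars A share the budget m, and the resulting
    sum of P'(C) is a missed-edge risk.  Taking c = mu^2 m / (2 (N - k)) + 1 then
    yields the theorem. *)

(** * Measurability on slots *)

(** The expectation of l is taken under the smaller support S because that law does not involve A: a
    single expected precision, at most m, is then divided among all candidate stars A at once. The
    term log k comes from counting: a union of k stars arises from k pairs (S, A), while each S
    leaves N - k + 1 choices of A, so averaging gains a factor k / (N - k + 1). Linearity is what
    permits this averaging, since miss probabilities and precisions are controlled only in sum and
    may be very uneven from star to star.

    Off the event C the tangent of exp(-l) at l = 0, weighted by exp(-c), replaces the tangent at l
    = c. The variable l then has the same coefficient on and off C, so only its mean D over the
    whole space enters, never its mean on C. The price is a term exp(-c) P'(not C), which is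
    absorbed by the constant 1.

    The likelihood ratio is built for finitely many records, whereas the estimator reads the whole
    infinite sequence. *)

Section slot_measurability.
Context d (V : measurableType d) (E : finType).

Lemma measurable_slotP (A : set (slot E V)) :
  measurable A <-> forall i, measurable [set v | A (Some (i, v))].
Proof. by []. Qed.

Lemma measurable_Some_slot (i : E) :
  measurable_fun [set: V] (fun v => Some (i, v) : slot E V).
Proof. by move=> _ B /measurable_slotP mB; rewrite setTI; exact: mB. Qed.

Lemma measurable_slot_index (i : E) :
  measurable [set a : slot E V | exists v, a = Some (i, v)].
Proof.
apply/measurable_slotP => i'; have [<-|ii'] := eqVneq i i'.
  rewrite (_ : mkset _ = setT)//.
  by apply/seteqP; split=> // v _; exists v.
rewrite (_ : mkset _ = set0)//.
by apply/seteqP; split=> // v [w [/esym/eqP]]; rewrite (negbTE ii').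
Qed.

Lemma measurable_slot_None : measurable [set None : slot E V].
Proof.
apply/measurable_slotP => i; rewrite (_ : mkset _ = set0)//.
by apply/seteqP; split.
Qed.

(** A measurable left inverse of [Some (i, _)]. The value [point] on the other copies only makes it
    total. *)
Definition slot_value (i : E) (a : slot E V) : V :=
  if a is Some (i', v) then if i' == i then v else point else point.

Lemma measurable_slot_value (i : E) : measurable_fun setT (slot_value i).
Proof.
move=> _ B mB; rewrite setTI; apply/measurable_slotP => i'.
have [<-|ii'] := eqVneq i' i.
  by rewrite (_ : mkset _ = B)//; apply/seteqP; split=> v /=; rewrite eqxx.
have [pB|pB] := pselect (B point).
  by rewrite (_ : mkset _ = setT)//; apply/seteqP; split=> v //=;
    rewrite (negbTE ii').
by rewrite (_ : mkset _ = set0)//; apply/seteqP; split=> v //=;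
  rewrite (negbTE ii').
Qed.

(** The product sigma-algebra on [slot E V * T] is not defined copy by copy. Since [E] is finite, a
    preimage is a finite union of pieces, and [slot_value] exhibits each piece as measurable. *)
Lemma measurable_fun_slot_pair d1 (T : measurableType d1) d2
    (Z : measurableType d2) (f : slot E V * T -> Z) :
  measurable_fun setT (fun t => f (None, t)) ->
  (forall i, measurable_fun setT (fun vt : V * T => f (Some (i, vt.1), vt.2))) ->
  measurable_fun setT f.
Proof.
move=> f0 fS _ B mB; rewrite setTI.
rewrite (_ : f @^-1` B = ([set None : slot E V] `*` ((fun t => f (None, t)) @^-1` B))
  `|` \bigcup_(i in [set: E])
   ((fst @^-1` [set a : slot E V | exists v, a = Some (i, v)]) `&`
    ((fun at_ : slot E V * T => (slot_value i at_.1, at_.2)) @^-1`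
      ((fun vt : V * T => f (Some (i, vt.1), vt.2)) @^-1` B)))).
  apply: measurableU.
    apply: measurableX; first exact: measurable_slot_None.
    by rewrite -[X in measurable X]setTI; exact: f0.
  apply: fin_bigcup_measurable; first exact: finite_finset.
  move=> i _; apply: measurableI.
    rewrite -[X in measurable X]setTI; apply: measurable_fst => //.
    exact: measurable_slot_index.
  rewrite -[X in measurable X]setTI.
  apply: (_ : measurable_fun setT _) => //.
    apply: measurable_fun_pair => //.
    by apply: (measurableT_comp (measurable_slot_value i)); exact: measurable_fst.
  by rewrite -[X in measurable X]setTI; exact: fS.
apply/seteqP; split=> [[[[i v]|] t] /= fB|[a t] /=].
- right; exists i => //; split=> /=; first by exists v.
  by rewrite eqxx.
- by left; split.
- case; first by case=> /= ->.
  by case=> i _ [/= [v ->]] /=; rewrite eqxx.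
Qed.

Lemma measurable_fun_slot d2 (Z : measurableType d2) (f : slot E V -> Z) :
  (forall i, measurable_fun setT (fun v : V => f (Some (i, v)))) ->
  measurable_fun setT f.
Proof.
move=> fS _ B mB; rewrite setTI; apply/measurable_slotP => i.
by have := fS i measurableT _ mB; rewrite setTI.
Qed.

End slot_measurability.

(** * Integration against a kernel of the past *)

Section disintegration.
Context d (T : measurableType d) (R : realType) (P : probability T R).
Context d1 d2 (T1 : measurableType d1) (T2 : measurableType d2).
Local Open Scope ereal_scope.
Context (k : R.-pker T1 ~> T2) (U : T -> T1) (mU : measurable_fun setT U).

(* The first component of the argument is a dummy: it gives the kernel the shape
   expected by [kcomp], whose integration lemma is used below. *)
Definition graph_kernel (x : T * T) : {measure set (T1 * T2) -> \bar R}.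
Proof.
by refine (pushforward (k (U x.2)) (pair (U x.2))); exact: pair1_measurable.
Defined.

Lemma graph_kernelE x C : graph_kernel x C = k (U x.2) (xsection C (U x.2)).
Proof.
rewrite /graph_kernel /= /pushforward; congr (k _ _).
by apply/seteqP; split=> y /=; rewrite /xsection /= inE.
Qed.

Let measurable_graph_kernel C : measurable C ->
  measurable_fun [set: T * T] (graph_kernel ^~ C : _ -> \bar R).
Proof.
move=> mC; rewrite (_ : (fun x => graph_kernel x C) =
  (fun u => k u (xsection C u)) \o (U \o snd)); last first.
  by apply/funext => x; rewrite /= graph_kernelE.
apply: measurableT_comp; last exact: measurableT_comp.
by apply: measurable_fun_xsection_finite_kernel; rewrite inE.
Qed.

HB.instance Definition _ := isKernel.Build _ _ (T * T)%type (T1 * T2)%type R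
  graph_kernel measurable_graph_kernel.

Let graph_kernel_setT x : graph_kernel x setT = 1.
Proof.
rewrite graph_kernelE (_ : xsection _ _ = setT) ?prob_kernel//.
by apply/seteqP; split=> // y _; rewrite /xsection /= inE.
Qed.

HB.instance Definition _ := Kernel_isProbability.Build _ _ _ _ R
  graph_kernel graph_kernel_setT.

Let cstP := fun _ : T => P : pprobability T R.
Let mcstP : measurable_fun setT cstP. Proof. exact: measurable_cst. Qed.

(** Rectangles form a pi-system generating the product, so the hypothesis on them already identifies
    the law of [(U, V)] with [P] composed with the kernel. Both the conditional law of a decision
    and the independence of the noise are used in this form. *)
Lemma integral_disintegration (V : T -> T2) (mV : measurable_fun setT V)
    (F : T1 * T2 -> \bar R) :
  (forall H C, measurable H -> measurable C ->
    P (U @^-1` H `&` V @^-1` C) = \int[P]_(w in U @^-1` H) k (U w) C) ->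
  measurable_fun setT F -> (forall x, 0 <= F x) ->
  \int[P]_w F (U w, V w) = \int[P]_w \int[k (U w)]_v F (U w, v).
Proof.
move=> UV mF F0.
pose UVw w := (U w, V w).
have mUV : measurable_fun setT UVw by exact: measurable_fun_pair.
transitivity (\int[pushforward P UVw]_z F z).
  by rewrite ge0_integral_pushforward//; exact: measurable_fun_pair.
transitivity (\int[kcomp (kprobability mcstP) graph_kernel point]_z F z).
  apply: eq_measure_integral => C mC _.
  pose G := [set A `*` B | A in @measurable _ T1 & B in @measurable _ T2].
  apply: (measure_unique G (fun=> setT)) => //.
  - exact: measurable_prod_measurableType.
  - move=> _ _ [A mA [B mB <-]] [A' mA' [B' mB' <-]]; rewrite -setXI.
    by exists (A `&` A'); [exact: measurableI|exists (B `&` B') => //;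
      exact: measurableI].
  - by move=> _; exists setT => //; exists setT => //; rewrite setXTT.
  - by rewrite bigcup_const//; exists 0%N.
  - move=> _ [H mH [D mD <-]].
    transitivity (P (U @^-1` H `&` V @^-1` D)) => //; rewrite UV//.
    transitivity (\int[P]_w graph_kernel (point, w) (H `*` D)) => //.
    rewrite integral_mkcond; apply: eq_integral => w _.
    rewrite graph_kernelE patchE /=.
    rewrite (_ : (w \in _) = (U w \in H)); last by apply/idP/idP; rewrite !inE.
    by case: ifPn => Uw; [rewrite in_xsectionX|rewrite notin_xsectionX ?measure0].
  - by move=> _; rewrite /= /pushforward preimage_setT probability_setT ltry.
rewrite integral_kcomp//.
apply: eq_integral => w _.
rewrite ge0_integral_pushforward//.
Qed.
End disintegration.

(** * The standard normal law *)

Section density.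
Context d (T : measurableType d) (R : realType).
Context (mu nu : {measure set T -> \bar R}) (f : T -> R).
Hypotheses (mf : measurable_fun setT f) (f0 : forall x, 0 <= f x).
Hypothesis nuE : forall A, measurable A -> nu A = (\int[mu]_(x in A) (f x)%:E)%E.
Local Open Scope ereal_scope.
Import HBNNSimple.

Let integral_density_nnsfun (h : {nnsfun T >-> R}) :
  \int[nu]_x (h x)%:E = \int[mu]_x ((h x)%:E * (f x)%:E).
Proof.
rewrite integralT_nnsfun sintegralE.
transitivity (\int[mu]_x \sum_(r \in range h)
    (r%:E * (\1_(h @^-1` [set r]) x * f x)%:E)); last first.
  apply: eq_integral => x _; rewrite [in RHS](fimfunE h) -EFinM.
  rewrite fsumEFin//; congr (_%:E); rewrite mulrC mulr_fsumr.
  by apply: eq_fsbigr => r _; rewrite [RHS]mulrC mulrA.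
have mA r : measurable (h @^-1` [set r]) by exact: measurable_sfunP.
rewrite ge0_integral_fsum//; last 2 first.
- move=> r; apply: measurable_funeM; apply/measurable_EFinP.
  by apply: measurable_funM => //; exact: measurable_indic.
- move=> r x _; have [r0|r0] := leP 0%R r.
    by rewrite -EFinM lee_fin !mulr_ge0.
  by rewrite preimage_nnfun0// indic0 mul0r mule0.
apply: eq_fsbigr => r _.
(* The sign must be settled for every real [r]; a negative one has an empty preimage, as [h] is
   nonnegative. *)
have [r0|r0] := leP 0%R r; last first.
  rewrite preimage_nnfun0// measure0 mule0 integral0_eq// => x _.
  by rewrite indic0 mul0r mule0.
rewrite ge0_integralZl//; last 2 first.
- by apply/measurable_EFinP/measurable_funM => //; exact: measurable_indic.
- by move=> x _; rewrite lee_fin mulr_ge0.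
congr (_ * _); rewrite nuE// integral_mkcond; apply: eq_integral => x _.
by rewrite patchE indicE; case: ifPn => _; rewrite ?mul1r ?mul0r.
Qed.

Lemma ge0_integral_density (F : T -> \bar R) :
  measurable_fun setT F -> (forall x, 0 <= F x) ->
  \int[nu]_x F x = \int[mu]_x (F x * (f x)%:E).
Proof.
move=> mF F0.
pose F_ := nnsfun_approx measurableT mF.
have cF z : (F_ n z)%:E @[n --> \oo] --> F z by exact: cvg_nnsfun_approx.
transitivity (\int[nu]_z (lim ((F_ n z)%:E @[n --> \oo]))).
  by apply/eq_integral => z _; apply/esym/cvg_lim.
rewrite monotone_convergence//; last 3 first.
  by move=> n; exact/measurable_EFinP.
  by move=> n z _; rewrite lee_fin.
  by move=> z _ a b ab; rewrite lee_fin; exact/lefP/nd_nnsfun_approx.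
under eq_fun do rewrite integral_density_nnsfun.
rewrite -monotone_convergence//; last 3 first.
- by move=> n; apply: emeasurable_funM => //; exact/measurable_EFinP.
- by move=> n z _; rewrite -EFinM lee_fin mulr_ge0.
- move=> z _ a b ab; rewrite -!EFinM lee_fin ler_wpM2r//.
  exact/lefP/nd_nnsfun_approx.
apply: eq_integral => z _; apply/cvg_lim => //.
exact: cvgeZr.
Qed.

End density.

Section lebesgue_translation.
Context (R : realType).
Local Notation mu := (@lebesgue_measure R).
Local Open Scope ereal_scope.

(** Lebesgue measure is determined by its values on half-open intervals, and a translation preserves
    their length. *)
Lemma ge0_integral_translation (c : R) (F : R -> \bar R) :
  measurable_fun setT F -> (forall x, 0 <= F x) ->
  \int[mu]_x F x = \int[mu]_x F (x + c)%R.
Proof.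
move=> mF F0.
have mc : measurable_fun setT (fun x : measurableTypeR R => x + c : measurableTypeR R)%R.
  exact: measurable_funD.
transitivity (\int[pushforward mu (fun x : measurableTypeR R =>
    x + c : measurableTypeR R)%R]_x F x); last first.
  by rewrite ge0_integral_pushforward.
apply: eq_measure_integral => A mA _; apply: lebesgue_measure_unique => //.
move=> _ [[a b]] _ <-; rewrite /= /pushforward.
rewrite (_ : _ @^-1` _ = `](a - c)%R, (b - c)%R]%classic); last first.
  by apply/seteqP; split=> x; rewrite /= !in_itv/= ltrBlDr lerBrDr.
rewrite !lebesgue_measure_itv/= !lte_fin ltrD2r; case: ifPn => // _.
by rewrite -!EFinD; congr (_%:E); ring.
Qed.

Lemma ge0_integral_reflection (F : R -> \bar R) :
  measurable_fun setT F -> (forall x, 0 <= F x) ->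
  \int[mu]_x F x = \int[mu]_x F (- x)%R.
Proof.
move=> mF F0.
transitivity (\int[pushforward mu (-%R : _ -> measurableTypeR R)]_x F x); last first.
  by rewrite ge0_integral_pushforward.
by apply: eq_measure_integral => A mA _; exact/esym/lebesgue_measureN.
Qed.
End lebesgue_translation.

Section standard_normal.
Context (R : realType).
Local Notation mu := (@lebesgue_measure R).
Local Notation gauss := (@normal_prob R 0 1).
Local Open Scope ereal_scope.

Let ge0_integral_gauss (F : R -> \bar R) :
  measurable_fun setT F -> (forall x, 0 <= F x) ->
  \int[gauss]_x F x = \int[mu]_x (F x * (normal_pdf 0 1 x)%:E).
Proof.
move=> mF F0; apply: ge0_integral_density => //.
- exact: measurable_normal_pdf.
- by move=> x; exact: normal_pdf_ge0.
Qed.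

Let normal_pdf_exp (x : R) :
  normal_pdf 0 1 x = (normal_peak 1 * expR (- x ^+ 2 / 2))%R.
Proof. by rewrite normal_pdfE ?oner_eq0// /normal_fun subr0 expr1n. Qed.

Let measurable_gauss_weight (delta : R) :
  measurable_fun [set: R] (fun x : R => expR (- (delta * x) - delta ^+ 2 / 2)).
Proof.
apply: measurableT_comp => //; apply: measurable_funB => //.
by apply: measurableT_comp => //; exact: mulrl_measurable.
Qed.

(** One-dimensional Cameron-Martin formula: the weight is the quotient of the normal densities at
    [x + delta] and at [x]. *)
Lemma ge0_integral_normal_translation (delta : R) (F : R -> \bar R) :
  measurable_fun setT F -> (forall x, 0 <= F x) ->
  \int[gauss]_x F x =
  \int[gauss]_x (F (x + delta)%R * (expR (- (delta * x) - delta ^+ 2 / 2))%:E).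
Proof.
move=> mF F0.
have mFd : measurable_fun setT (fun x : R => F (x + delta)%R).
  by apply: measurableT_comp => //; exact: measurable_funD.
have mpdf : measurable_fun setT (EFin \o @normal_pdf R 0 1).
  by apply/measurable_EFinP; exact: measurable_normal_pdf.
rewrite !ge0_integral_gauss//; last 2 first.
- by apply: emeasurable_funM => //; exact/measurable_EFinP.
- by move=> x; rewrite mule_ge0// lee_fin expR_ge0.
rewrite (ge0_integral_translation delta); last 2 first.
- exact: emeasurable_funM.
- by move=> x; rewrite mule_ge0// lee_fin normal_pdf_ge0.
apply: eq_integral => x _; rewrite -muleA -EFinM; congr (_ * _%:E).
by rewrite !normal_pdf_exp mulrCA -expRD; congr (_ * expR _)%R; field.
Qed.

Lemma ge0_integral_normal_reflection (F : R -> \bar R) :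
  measurable_fun setT F -> (forall x, 0 <= F x) ->
  \int[gauss]_x F x = \int[gauss]_x F (- x)%R.
Proof.
move=> mF F0.
have mFN : measurable_fun setT (fun x : R => F (- x)%R) by exact: measurableT_comp.
rewrite (ge0_integral_gauss mF F0) (ge0_integral_gauss mFN (fun x => F0 (- x)%R)).
rewrite ge0_integral_reflection; last 2 first.
- apply: emeasurable_funM => //.
  by apply/measurable_EFinP; exact: measurable_normal_pdf.
- by move=> x; rewrite mule_ge0// lee_fin normal_pdf_ge0.
by apply: eq_integral => x _; rewrite !normal_pdf_exp sqrrN.
Qed.

(** The bound |x| <= exp x + exp(-x) reduces the first moment to exponential moments. These come
    from the translation formula with [delta = -1] and a constant function, together with
    reflection. *)
Lemma integral_normal_norm_lty : \int[gauss]_x (`|x|%:E) < +oo.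
Proof.
have exp_mean : \int[gauss]_x (expR (x - 2^-1))%:E = 1.
  transitivity (\int[gauss]_x cst 1 x); last first.
    by rewrite integral_cst// mul1e; exact: probability_setT.
  rewrite [RHS](ge0_integral_normal_translation (-1)%R)//.
  by apply: eq_integral => x _; rewrite mul1e; congr (expR _)%:E; field.
have mexp : measurable_fun setT (fun x : R => (expR (x - 2^-1))%:E).
  by apply/measurable_EFinP/measurableT_comp => //; exact: measurable_funB.
have mexpN : measurable_fun setT (fun x : R => (expR (- x - 2^-1))%:E).
  by apply: (measurableT_comp mexp).
have mabs : measurable_fun setT (fun x : R => `|x|%:E).
  by apply/measurable_EFinP; exact: normr_measurable.
apply: (@le_lt_trans _ _ (\int[gauss]_x ((expR 2^-1)%:E *
    ((expR (x - 2^-1))%:E + (expR (- x - 2^-1))%:E)))).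
  apply: ge0_le_integral => //.
  - by apply: measurable_funeM; exact: emeasurable_funD.
  - move=> x _; rewrite -EFinD -EFinM lee_fin mulrDr -!expRD.
    rewrite !(addrC 2^-1%R) !subrK.
    have := expR_ge1Dx x; have := expR_ge1Dx (- x).
    have := expR_gt0 x; have := expR_gt0 (- x).
    move: (expR x) (expR (- x)) => a b.
    by have [] := ger0P x; lra.
rewrite ge0_integralZl//; last 2 first.
- exact: emeasurable_funD.
- by move=> x _; rewrite -EFinD lee_fin addr_ge0 ?expR_ge0.
rewrite ge0_integralD//.
rewrite -(ge0_integral_normal_reflection mexp); last first.
  by move=> x; rewrite lee_fin expR_ge0.
by rewrite exp_mean -EFinD -EFinM ltry.
Qed.

End standard_normal.

(** * The experiment *)

Lemma measurable_sqrt (R : realType) : measurable_fun [set: R] (@Num.sqrt R).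
Proof.
by apply: nondecreasing_measurable => // x y xy; exact: ler_wsqrtr.
Qed.

(** For positive [g] the inverse is an exponential of a logarithm; for the others [Num.sqrt g] is 0
    and so is its inverse, by convention. *)
Lemma measurable_inv_sqrt (R : realType) :
  measurable_fun [set: R] (fun g : R => (Num.sqrt g)^-1).
Proof.
rewrite (_ : (fun g => _) =
    (fun g => if 0 < g then expR (- ln (Num.sqrt g)) else 0)); last first.
  apply/funext => g; case: ltP => g0; last by rewrite ler0_sqrtr// invr0.
  by rewrite expRN lnK// posrE sqrtr_gt0.
apply: measurable_fun_ifT => //.
- exact: measurable_fun_ltr.
- apply: measurableT_comp => //; apply: measurableT_comp => //.
  by apply: measurableT_comp => //; exact: measurable_sqrt.
Qed.

Section run.
Context (R : realType) (E : finType) (x : E -> R) (proc : procedure R E).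
Context (X : experiment x proc).
Local Notation P := (law X).
Local Notation gauss := (@normal_prob R 0 1).
Local Open Scope ereal_scope.

Lemma measurable_measure_slot :
  measurable_fun setT
    (fun aw : decision R E * R => measure_slot x aw.1 aw.2 : record R E).
Proof.
apply: measurable_fun_slot_pair => [|i]; first exact: measurable_cst.
apply: (measurableT_comp (measurable_Some_slot i)
  (g := fun gw : R * R => (gw.1, x i + (Num.sqrt gw.1)^-1 * gw.2)%R)).
apply: measurable_fun_pair; first exact: measurable_fst.
apply: measurable_funD; first exact: measurable_cst.
apply: measurable_funM; last exact: measurable_snd.
by apply: (measurableT_comp (@measurable_inv_sqrt R)); exact: measurable_fst.
Qed.

Lemma measurable_data j : measurable_fun setT (data X j).
Proof.
apply: (measurableT_comp measurable_measure_slot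
  (g := fun w => (decide X j w, noise X j w))).
by apply: measurable_fun_pair; [exact: measurable_decide|exact: measurable_noise].
Qed.

Lemma measurable_past j : measurable_fun setT (past (data X) j).
Proof.
apply/measurable_fun_tnthP => i.
rewrite (_ : _ \o _ = data X i); first exact: measurable_data.
by apply/funext => w; rewrite /= tnth_mktuple.
Qed.

Lemma integral_decide j (F : j.-tuple (record R E) * decision R E -> \bar R) :
  measurable_fun setT F -> (forall z, 0 <= F z) ->
  \int[P]_w F (past (data X) j w, decide X j w) =
  \int[P]_w \int[rule proc j (past (data X) j w)]_a F (past (data X) j w, a).
Proof.
move=> mF F0; apply: integral_disintegration => //.
- exact: measurable_past.
- exact: measurable_decide.
- exact: decide_conditional_law.
Qed.

Lemma integral_noise j
    (F : (j.-tuple (record R E) * decision R E) * R -> \bar R) :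
  measurable_fun setT F -> (forall z, 0 <= F z) ->
  \int[P]_w F (past (data X) j w, decide X j w, noise X j w) =
  \int[P]_w \int[gauss]_v F (past (data X) j w, decide X j w, v).
Proof.
move=> mF F0.
pose U w := (past (data X) j w, decide X j w).
have mU : measurable_fun setT U.
  by apply: measurable_fun_pair; [exact: measurable_past|exact: measurable_decide].
pose g1 : probability (measurableTypeR R) R := gauss.
(* Independence of the noise from the past and the decision is disintegration along a constant
   kernel. *)
pose kg (_ : j.-tuple (record R E) * decision R E) : pprobability _ R := g1.
have mkg : measurable_fun setT kg by exact: measurable_cst.
apply: (@integral_disintegration _ _ _ P _ _ _ _ (kprobability mkg) U mU) => //.
- exact: measurable_noise.
- move=> H C mH mC; rewrite integral_cst//; last first.
    by rewrite -[X in measurable X]setTI; exact: mU.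
  by rewrite setIC (noise_independent_past X)// noise_normal.
Qed.

End run.

(** * Likelihood ratios *)

Section past_rcons.
Context (R : realType) (E : finType).

Definition extend_past j (hr : j.-tuple (record R E) * record R E) :
  j.+1.-tuple (record R E) := [tuple of rcons hr.1 hr.2].

Lemma measurable_extend_past j : measurable_fun setT (@extend_past j).
Proof.
apply/measurable_fun_tnthP => i; have [ij|ji] := ltnP i j.
  rewrite (_ : _ \o _ = (fun h => tnth h (Ordinal ij)) \o fst); last first.
    apply/funext => -[h r]; rewrite /= !(tnth_nth r) /=.
    by rewrite nth_rcons size_tuple ij.
  by apply: measurableT_comp => //; exact: measurable_tnth.
rewrite (_ : _ \o _ = snd); first exact: measurable_snd.
apply/funext => -[h r]; rewrite /= (tnth_nth r) /= nth_rcons size_tuple.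
have -> : i = j :> nat by apply/eqP; rewrite eqn_leq ji -ltnS ltn_ord.
by rewrite ltnn eqxx.
Qed.

Lemma nth_extend_past j (h : j.-tuple (record R E)) r n :
  nth None (extend_past (h, r)) n =
  if (n < j)%N then nth None h n else if n == j then r else None.
Proof. by rewrite /= nth_rcons size_tuple. Qed.

Lemma pastS T (D : nat -> T -> record R E) j w :
  past D j.+1 w = extend_past (past D j w, D j w).
Proof.
apply: eq_from_tnth => i; rewrite tnth_mktuple (tnth_nth None) nth_extend_past.
case: (ltngtP i j) => [ij|ji|-> //]; last first.
  by have := ltn_ord i; rewrite ltnS leqNgt ji.
by have := tnth_nth None (past D j w) (Ordinal ij); rewrite tnth_mktuple => ->.
Qed.

End past_rcons.

Section likelihood_ratio.
Context (R : realType) (E : finType) (x x' : E -> R).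

(** The difference of the two means in units of the noise deviation. Half its square is the
    Kullback-Leibler divergence of one observation. *)
Definition drift (a : decision R E) : R :=
  if a is Some (i, g) then Num.sqrt g * (x i - x' i) else 0.

(* The log-likelihood ratio of [x] against [x']; meaningful for positive
   precisions only, where [Num.sqrt g * (y - x i)] recovers the noise. *)
Definition record_llr (r : record R E) : R :=
  if r is Some (i, (g, y)) then
    drift (Some (i, g)) * (Num.sqrt g * (y - x i)) + drift (Some (i, g)) ^+ 2 / 2
  else 0.

Definition past_llr j (h : j.-tuple (record R E)) : R :=
  \sum_(i < j) record_llr (tnth h i).

Lemma measurable_drift : measurable_fun setT drift.
Proof.
apply: measurable_fun_slot => i /=.
apply: measurable_funM; last exact: measurable_cst.
exact: measurable_sqrt.
Qed.

Lemma measurable_record_llr : measurable_fun setT record_llr.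
Proof.
apply: measurable_fun_slot => i /=.
rewrite (_ : (fun _ => _) = (fun gy : R * R =>
  Num.sqrt gy.1 * (x i - x' i) * (Num.sqrt gy.1 * (gy.2 - x i)) +
  (Num.sqrt gy.1 * (x i - x' i)) ^+ 2 / 2)); last by apply/funext => -[].
have msq : measurable_fun setT (fun gy : R * R => Num.sqrt gy.1).
  by apply: (measurableT_comp (@measurable_sqrt R)); exact: measurable_fst.
have mdr : measurable_fun setT (fun gy : R * R => Num.sqrt gy.1 * (x i - x' i)).
  by apply: measurable_funM => //; exact: measurable_cst.
apply: measurable_funD.
  apply: measurable_funM => //; apply: measurable_funM => //.
  apply: measurable_funB; last exact: measurable_cst.
  exact: measurable_snd.
apply: measurable_funM; last exact: measurable_cst.
exact: measurable_funX.
Qed.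

Lemma measurable_past_llr j : measurable_fun setT (@past_llr j).
Proof.
apply: measurable_sum => i.
by apply: measurableT_comp; [exact: measurable_record_llr|exact: measurable_tnth].
Qed.

Lemma past_llrS j (hr : j.-tuple (record R E) * record R E) :
  past_llr (extend_past hr) = past_llr hr.1 + record_llr hr.2.
Proof.
case: hr => h r; rewrite /past_llr big_ord_recr /=; congr (_ + record_llr _).
  apply: eq_bigr => i _; congr record_llr.
  by rewrite !(tnth_nth r) /= nth_rcons size_tuple ltn_ord.
by rewrite (tnth_nth r) /= nth_rcons size_tuple ltnn eqxx.
Qed.

Lemma record_llr_measure (a : decision R E) (v : R) :
  (forall i g, a = Some (i, g) -> 0 < g) ->
  record_llr (measure_slot x a v) = drift a * v + drift a ^+ 2 / 2.
Proof.
case: a => [[i g]|] /= gt0; last by rewrite mul0r expr0n/= mul0r addr0.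
have g0 : Num.sqrt g != 0 by rewrite gt_eqF// sqrtr_gt0 (gt0 i).
by rewrite [x i + _ - x i]addrC addrA addNr add0r mulVKf.
Qed.

(* Translating the noise by the drift turns an observation of [x'] into one of
   [x], so the Gaussian translation formula is the one-step change of measure. *)
Lemma measure_slot_drift (a : decision R E) (v : R) :
  (forall i g, a = Some (i, g) -> 0 < g) ->
  measure_slot x' a (v + drift a) = measure_slot x a v.
Proof.
case: a => [[i g]|] //= gt0; congr (Some (_, (_, _))).
have g0 : Num.sqrt g != 0 by rewrite gt_eqF// sqrtr_gt0 (gt0 i).
by rewrite mulrDr mulKf//; ring.
Qed.

End likelihood_ratio.

Section change_of_measure.
Context (R : realType) (E : finType) (x x' : E -> R) (proc : procedure R E).
Context (X : experiment x proc) (X' : experiment x' proc).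
Local Notation gauss := (@normal_prob R 0 1).
Local Notation drift := (drift x x').
Local Notation record_llr := (record_llr x x').
Local Notation past_llr := (@past_llr R E x x' _).
Local Open Scope ereal_scope.

Let measurable_measured j (y : E -> R) :
  measurable_fun setT
    (fun z : (j.-tuple (record R E) * decision R E) * R =>
      extend_past (z.1.1, measure_slot y z.1.2 z.2)).
Proof.
apply: (measurableT_comp (@measurable_extend_past R E j)
  (g := fun z : (j.-tuple (record R E) * decision R E) * R =>
    (z.1.1, measure_slot y z.1.2 z.2))).
apply: measurable_fun_pair; first exact: measurableT_comp.
apply: (measurableT_comp (measurable_measure_slot y)
  (g := fun z : (j.-tuple (record R E) * decision R E) * R => (z.1.2, z.2))).
apply: measurable_fun_pair; first exact: measurableT_comp.
exact: measurable_snd.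
Qed.

(** Decisions are drawn from the same kernels under both signals and contribute nothing to the
    ratio; only the noise does. In the induction the last noise and then the last decision are
    integrated out under [X'], the induction hypothesis moves the past to [X], and the two
    integrations are undone there. *)
Lemma integral_past_change_of_measure j (F : j.-tuple (record R E) -> \bar R) :
  measurable_fun setT F -> (forall h, 0 <= F h) ->
  \int[law X']_w F (past (data X') j w) =
  \int[law X]_w (F (past (data X) j w) *
    (expR (- past_llr (past (data X) j w)))%:E).
Proof.
elim: j F => [|j IH] F mF F0.
  have past0 T (D : nat -> T -> record R E) w : past D 0 w = [tuple] by exact: tuple0.
  under eq_integral do rewrite past0.
  under [in RHS]eq_integral do rewrite past0 /past_llr big_ord0 oppr0 expR0 mule1.
  rewrite !integral_cst//; congr (_ * _).
  by transitivity (1 : \bar R); [|symmetry]; exact: probability_setT.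
have mFx y : measurable_fun setT
    (fun z : (j.-tuple (record R E) * decision R E) * R =>
      F (extend_past (z.1.1, measure_slot y z.1.2 z.2))).
  exact: (measurableT_comp mF (@measurable_measured j y)).
pose G (z : (j.-tuple (record R E) * decision R E) * R) :=
  F (extend_past (z.1.1, measure_slot x z.1.2 z.2)) *
  (expR (- record_llr (measure_slot x z.1.2 z.2)))%:E.
have mG : measurable_fun setT G.
  apply: emeasurable_funM; first exact: mFx.
  apply/measurable_EFinP; apply: measurableT_comp => //.
  apply: measurableT_comp => //.
  apply: (measurableT_comp (measurable_record_llr x x')).
  apply: (measurableT_comp (measurable_measure_slot x)
    (g := fun z : (j.-tuple (record R E) * decision R E) * R => (z.1.2, z.2))).
  apply: measurable_fun_pair; first exact: measurableT_comp.
  exact: measurable_snd.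
have G0 z : 0 <= G z by rewrite mule_ge0// lee_fin expR_ge0.
(* After the noise is translated by the drift, the integrand mentions [x] only, so this same
   function serves both experiments. *)
pose Psi z := \int[gauss]_v G (z, v).
have mPsi : measurable_fun setT Psi.
  exact: (measurable_fun_fubini_tonelli_F (m2 := gauss) G mG G0).
have Psi0 z : 0 <= Psi z by exact: integral_ge0.
transitivity (\int[law X']_w Psi (past (data X') j w, decide X' j w)).
  under eq_integral do rewrite pastS.
  rewrite (@integral_noise _ _ _ _ X' j (fun z =>
    F (extend_past (z.1.1, measure_slot x' z.1.2 z.2)))); last 2 first.
  - exact: mFx.
  - by move=> z; exact: F0.
  apply: eq_integral => w _ /=.
  have gt0 : forall i g, decide X' j w = Some (i, g) -> (0 < g)%R.
    by move=> i g; exact: decide_precision_gt0.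
  rewrite (ge0_integral_normal_translation (drift (decide X' j w))); last 2 first.
  - by apply: (measurableT_comp (mFx x')
      (g := pair (past (data X') j w, decide X' j w))); exact: pair1_measurable.
  - by move=> v; exact: F0.
  apply: eq_integral => v _.
  rewrite /G /= measure_slot_drift// record_llr_measure// opprD.
  by [].
(* Averaging over the decision leaves a function of the past alone, to which the induction
   hypothesis applies. *)
rewrite integral_decide//.
rewrite (IH (fun h => \int[rule proc j h]_a Psi (h, a))); last 2 first.
- exact: (@measurable_kfcomp _ _ _ _ _ (rule proc j) Psi).
- by move=> h; exact: integral_ge0.
pose Z j (h : j.-tuple (record R E)) := (expR (- past_llr h))%:E.
have mZ i : measurable_fun setT (Z i).
  apply/measurable_EFinP; apply: measurableT_comp => //.
  by apply: measurableT_comp => //; exact: measurable_past_llr.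
have Z0 i h : 0 <= Z i h by rewrite lee_fin expR_ge0.
transitivity (\int[law X]_w (Psi (past (data X) j w, decide X j w) *
    Z j (past (data X) j w))).
  rewrite (@integral_decide _ _ _ _ X j (fun z => Psi z * Z j z.1)); last 2 first.
  - apply: emeasurable_funM => //.
    by apply: (measurableT_comp (mZ j)); exact: measurable_fst.
  - by move=> z; exact: mule_ge0.
  apply: eq_integral => w _; symmetry.
  have mPw := measurableT_comp mPsi (pair1_measurable (past (data X) j w)).
  by rewrite -(ge0_integralZr (rule proc j (past (data X) j w)) measurableT mPw
    (fun v _ => Psi0 _) (Z0 _ _)).
transitivity (\int[law X]_w \int[gauss]_v
    (G (past (data X) j w, decide X j w, v) * Z j (past (data X) j w))).
  apply: eq_integral => w _; symmetry; rewrite /Psi.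
  have mGw := measurableT_comp mG (pair1_measurable (past (data X) j w, decide X j w)).
  by rewrite -(ge0_integralZr gauss measurableT mGw (fun v _ => G0 _) (Z0 _ _)).
rewrite -(@integral_noise _ _ _ _ X j (fun z => G z * Z j z.1.1)); last 2 first.
- apply: emeasurable_funM => //; apply: (measurableT_comp (mZ j)).
  exact: measurableT_comp.
- by move=> z; exact: mule_ge0.
apply: eq_integral => w _; rewrite pastS /G /Z /= past_llrS /=.
rewrite -muleA -EFinM -expRD; congr (_ * (expR _)%:E).
by rewrite /data opprD addrC.
Qed.

End change_of_measure.

(** * Mean of the log-likelihood ratio *)

Section expected_llr.
Context (R : realType) (E : finType) (x x' : E -> R) (proc : procedure R E).
Context (X : experiment x proc).
Local Notation gauss := (@normal_prob R 0 1).
Local Notation drift := (drift x x').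
Local Open Scope ereal_scope.

Definition drift_energy j : \bar R :=
  \int[law X]_w (drift (decide X j w) ^+ 2 / 2)%:E.

Let mdrift j : measurable_fun setT (fun w => drift (decide X j w)).
Proof.
by apply: (measurableT_comp (measurable_drift x x')); exact: measurable_decide.
Qed.

Let menergy j : measurable_fun setT (fun w => drift (decide X j w) ^+ 2 / 2)%R.
Proof.
apply: measurable_funM; last exact: measurable_cst.
exact: measurable_funX.
Qed.

Let energy_ge0 j w : 0 <= (drift (decide X j w) ^+ 2 / 2)%:E.
Proof. by rewrite lee_fin divr_ge0// sqr_ge0. Qed.

Lemma drift_energy_ge0 j : 0 <= drift_energy j.
Proof. by apply: integral_ge0 => w _; exact: energy_ge0. Qed.

Let integral_drift_noise_fun j (f : R -> R) : measurable_fun setT f ->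
    (forall t, 0 <= f t)%R ->
  \int[law X]_w (f (drift (decide X j w) * noise X j w))%:E =
  \int[law X]_w \int[gauss]_v (f (drift (decide X j w) * v))%:E.
Proof.
move=> mf f0.
apply: (@integral_noise _ _ _ _ X j (fun z => (f (drift z.1.2 * z.2))%:E)).
  apply/measurable_EFinP; apply: measurableT_comp => //.
  apply: measurable_funM; last exact: measurable_snd.
  apply: (measurableT_comp (measurable_drift x x')).
  exact: measurableT_comp.
by move=> z; rewrite lee_fin.
Qed.

(** Given the decision, the noise is still standard normal, so the absolute moment of the product
    factors into those of the drift and of the noise. *)
Lemma integrable_drift_noise j : drift_energy j < +oo ->
  (law X).-integrable setT (fun w => (drift (decide X j w) * noise X j w)%:E).
Proof.
move=> Dj; apply/integrableP; split.
  by apply/measurable_EFinP; apply: measurable_funM => //; exact: measurable_noise.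
rewrite (integral_drift_noise_fun j (f := Num.norm))//.
have mnorm : measurable_fun [set: R] (fun v : R => `|v|%:E).
  by apply/measurable_EFinP; exact: normr_measurable.
have gE d : \int[gauss]_v `|d * v|%:E = `|d|%:E * \int[gauss]_v `|v|%:E.
  under eq_integral do rewrite normrM EFinM.
  by rewrite ge0_integralZl//.
under eq_integral do rewrite gE.
have mnd : measurable_fun setT (fun w => `|drift (decide X j w)|%:E).
  by apply/measurable_EFinP; apply: measurableT_comp.
rewrite ge0_integralZr//; last exact: integral_ge0.
apply: lte_mul_pinfty => //.
- exact: integral_ge0.
- rewrite ge0_fin_numE//; last exact: integral_ge0.
  apply: (@le_lt_trans _ _ (\int[law X]_w (1 + (drift (decide X j w) ^+ 2 / 2)%:E))).
    apply: ge0_le_integral => //.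
    + by apply: emeasurable_funD => //; exact/measurable_EFinP.
    + move=> w _; rewrite -EFinD lee_fin; move: (drift _) => t.
      (* This square gives |t| <= (1 + t^2) / 2, so a finite energy bounds the first moment of the
         drift. *)
      have := sqr_ge0 (`|t| - 1)%R; rewrite sqrrB -normrX expr1n mulr1 ger0_norm ?sqr_ge0//.
      lra.
  rewrite ge0_integralD//; last exact/measurable_EFinP.
  rewrite integral_cst// mul1e lte_add_pinfty//.
  by rewrite [ltLHS](_ : _ = 1) ?ltry//; exact: probability_setT.
- exact: integral_normal_norm_lty.
Qed.

(** For a fixed decision, reflecting the noise exchanges the positive and negative parts;
    integrability then lets them cancel. *)
Lemma integral_drift_noise j : drift_energy j < +oo ->
  \int[law X]_w (drift (decide X j w) * noise X j w)%:E = 0.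
Proof.
move=> /integrable_drift_noise int_dn.
rewrite integralE.
have -> : \int[law X]_w (fun w => (drift (decide X j w) * noise X j w)%:E)^\- w =
          \int[law X]_w (fun w => (drift (decide X j w) * noise X j w)%:E)^\+ w.
  transitivity (\int[law X]_w (Num.max (- (drift (decide X j w) * noise X j w)) 0)%R%:E).
    by apply: eq_integral => w _; rewrite funenegE -EFin_max.
  transitivity (\int[law X]_w (Num.max (drift (decide X j w) * noise X j w) 0)%R%:E); last first.
    by apply: eq_integral => w _; rewrite funeposE -EFin_max.
  rewrite (integral_drift_noise_fun j (f := fun t : R => Num.max (- t) 0)%R); last 2 first.
  - by apply: measurable_maxr => //; exact: measurable_cst.
  - by move=> t; rewrite le_max lexx orbT.
  rewrite (integral_drift_noise_fun j (f := fun t : R => Num.max t 0)%R); last 2 first.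
  - by apply: measurable_maxr => //; exact: measurable_cst.
  - by move=> t; rewrite le_max lexx orbT.
  apply: eq_integral => w _.
  rewrite [RHS]ge0_integral_normal_reflection//; last 2 first.
  - apply/measurable_EFinP; apply: measurable_maxr; last exact: measurable_cst.
    exact: mulrl_measurable.
  - by move=> v; rewrite lee_fin le_max lexx orbT.
  by apply: eq_integral => v _; rewrite mulrN.
by rewrite subee// integrable_pos_fin_num.
Qed.

Let record_llr_data j w : record_llr x x' (data X j w) =
  (drift (decide X j w) * noise X j w + drift (decide X j w) ^+ 2 / 2)%R.
Proof.
by apply: record_llr_measure => i g; exact: decide_precision_gt0.
Qed.

Let integrable_energy j : drift_energy j < +oo ->
  (law X).-integrable setT (fun w => (drift (decide X j w) ^+ 2 / 2)%:E).
Proof.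
move=> Dj; apply/integrableP; split; first exact/measurable_EFinP.
by under eq_integral do rewrite gee0_abs//.
Qed.

Lemma integrable_record_llr j : drift_energy j < +oo ->
  (law X).-integrable setT (fun w => (record_llr x x' (data X j w))%:E).
Proof.
move=> Dj; under eq_fun do rewrite record_llr_data EFinD.
by apply: integrableD => //; [exact: integrable_drift_noise|exact: integrable_energy].
Qed.

Lemma integral_record_llr j : drift_energy j < +oo ->
  \int[law X]_w (record_llr x x' (data X j w))%:E = drift_energy j.
Proof.
move=> Dj; under eq_integral do rewrite record_llr_data EFinD.
rewrite integralD//; last 2 first.
- exact: integrable_drift_noise.
- exact: integrable_energy.
by rewrite integral_drift_noise// add0e.
Qed.

Let past_llr_sum j w : (past_llr x x' (past (data X) j w))%:E =
  \sum_(i < j) (record_llr x x' (data X i w))%:E.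
Proof.
by rewrite sumEFin; congr (_%:E); apply: eq_bigr => i _; rewrite tnth_mktuple.
Qed.

Lemma integrable_past_llr j : (forall i, (i < j)%N -> drift_energy i < +oo) ->
  (law X).-integrable setT (fun w => (past_llr x x' (past (data X) j w))%:E).
Proof.
move=> Dj; under eq_fun do rewrite past_llr_sum.
by apply: integrable_sum => // i _; apply: integrable_record_llr; exact: Dj.
Qed.

Lemma integral_past_llr j : (forall i, (i < j)%N -> drift_energy i < +oo) ->
  \int[law X]_w (past_llr x x' (past (data X) j w))%:E =
  \sum_(i < j) drift_energy i.
Proof.
move=> Dj; under eq_integral do rewrite past_llr_sum.
rewrite integral_sum//; last by move=> i; apply: integrable_record_llr; exact: Dj.
by apply: eq_bigr => i _; rewrite integral_record_llr//; exact: Dj.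
Qed.

End expected_llr.

(** * Transfer of an event with a finite horizon *)

Section past_event_bound.
Context (R : realType) (E : finType) (x x' : E -> R) (proc : procedure R E).
Context (X : experiment x proc) (X' : experiment x' proc).
Local Open Scope ereal_scope.

(** On the event, exp(c - l) >= 1 + (c - l); off it, exp(-l) >= 1 - l. The weight exp(-c) off the
    event merges the two cases into one expression linear in [b] and [l]. *)
Let tangent_bound (c l : R) (b : bool) :
  (expR (- c) * (c * b%:R + 1 - l) <=
   (b%:R + expR (- c) * (~~ b)%:R) * expR (- l))%R.
Proof.
case: b; rewrite /= ?mulr1n ?mulr0n !(mulr1, mulr0, mul1r, addr0, add0r).
  have -> : expR (- l) = (expR (- c) * expR (c - l))%R.
    by rewrite -expRD; congr expR; ring.
  have -> : (c + 1 - l = 1 + (c - l))%R by ring.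
  rewrite ler_pM2l ?expR_gt0//; exact: expR_ge1Dx.
rewrite ler_pM2l ?expR_gt0//; exact: expR_ge1Dx.
Qed.

Lemma past_event_bound j (B : set (j.-tuple (record R E))) (c : R) :
  measurable B -> (forall i, (i < j)%N -> drift_energy x' X i < +oo) ->
  (expR (- c))%:E *
    (c%:E * law X (past (data X) j @^-1` B) + 1 - \sum_(i < j) drift_energy x' X i)
  <= law X' (past (data X') j @^-1` B) +
     (expR (- c))%:E * law X' (past (data X') j @^-1` (~` B)).
Proof.
move=> mB Dj.
pose F h := (\1_B h + expR (- c) * \1_(~` B) h)%R.
have F0 h : (0 <= F h)%R by rewrite addr_ge0// mulr_ge0 ?expR_ge0.
have mF : measurable_fun setT F.
  apply: measurable_funD; first exact: measurable_indic.
  apply: measurable_funM; first exact: measurable_cst.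
  by apply: measurable_indic; exact: measurableC.
have mpast C (mC : measurable C) : measurable (past (data X) j @^-1` C).
  by rewrite -[X in measurable X]setTI; exact: measurable_past.
have mpast' C (mC : measurable C) : measurable (past (data X') j @^-1` C).
  by rewrite -[X in measurable X]setTI; exact: measurable_past.
pose L w := past_llr x x' (past (data X) j w).
have intL : (law X).-integrable setT (EFin \o L) by exact: integrable_past_llr.
have int1 (C : set (j.-tuple (record R E))) : measurable C ->
  (law X).-integrable setT (fun w => (\1_C (past (data X) j w))%:E).
  by move=> mC; exact: (integrable_indic (law X) (mpast _ mC)).
have int1C : (law X).-integrable setT
    (fun w => (expR (- c) * (c * \1_B (past (data X) j w) + 1 - L w))%:E).
  under eq_fun do rewrite EFinM EFinB EFinD EFinM.
  apply: integrableZl => //; apply: integrableB => //; apply: integrableD => //.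
    by apply: integrableZl => //; exact: int1.
  exact: finite_measure_integrable_cst.
have RHSE : law X' (past (data X') j @^-1` B) +
     (expR (- c))%:E * law X' (past (data X') j @^-1` (~` B)) =
   \int[law X]_w (F (past (data X) j w) * expR (- L w))%:E.
  transitivity (\int[law X']_w (F (past (data X') j w))%:E).
    under eq_integral do rewrite EFinD EFinM.
    have m1 C : measurable C ->
        measurable_fun setT (fun w => (\1_C (past (data X') j w))%:E : \bar R).
      by move=> mC; apply/measurable_EFinP; exact: (measurable_indic (mpast' _ mC)).
    have int1' C : measurable C -> \int[law X']_w (\1_C (past (data X') j w))%:E =
        law X' (past (data X') j @^-1` C).
      move=> mC; transitivity (\int[law X']_w (\1_(past (data X') j @^-1` C) w)%:E) => //.
      by rewrite integral_indic ?setIT//; exact: mpast'.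
    rewrite -!int1'//; last exact: measurableC.
    rewrite -ge0_integralZl//; last by apply: m1; exact: measurableC.
    rewrite -ge0_integralD//.
    - exact: m1.
    - by apply: measurable_funeM; apply: m1; exact: measurableC.
  by rewrite (integral_past_change_of_measure X X' (F := EFin \o F))//;
    exact/measurable_EFinP.
have -> : (expR (- c))%:E *
    (c%:E * law X (past (data X) j @^-1` B) + 1 - \sum_(i < j) drift_energy x' X i) =
  \int[law X]_w (expR (- c) * (c * \1_B (past (data X) j w) + 1 - L w))%:E.
  under eq_integral do rewrite EFinM EFinB EFinD EFinM.
  have intc1 : (law X).-integrable setT
      (fun w => c%:E * (\1_B (past (data X) j w))%:E).
    by apply: integrableZl => //; exact: int1.
  have intD : (law X).-integrable setT
      (fun w => c%:E * (\1_B (past (data X) j w))%:E + 1).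
    by apply: integrableD => //; exact: finite_measure_integrable_cst.
  rewrite integralZl//; last exact: integrableB.
  rewrite integralB// integralD//; last exact: finite_measure_integrable_cst.
  rewrite integralZl//; last exact: int1.
  rewrite integral_past_llr//; congr (_ * (_ * _ + _ - _)).
    transitivity (\int[law X]_w (\1_(past (data X) j @^-1` B) w)%:E) => //.
    by rewrite integral_indic ?setIT//; exact: mpast.
  by rewrite integral_cst// mul1e; apply/esym; exact: probability_setT.
rewrite RHSE; apply: le_integral => //.
- apply/integrableP; split.
    apply/measurable_EFinP; apply: measurable_funM.
      by apply: (measurableT_comp mF); exact: measurable_past.
    apply: measurableT_comp => //; apply: measurableT_comp => //.
    exact/measurable_EFinP/(measurable_int (law X)).
  under eq_integral do rewrite gee0_abs ?lee_fin ?mulr_ge0 ?expR_ge0//.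
  (* Integrability needs no estimate of the likelihood ratio: by [RHSE] the integral is a finite
     combination of probabilities under [X']. *)
  rewrite -RHSE -ge0_fin_numE; last by rewrite adde_ge0 ?mule_ge0 ?lee_fin ?expR_ge0.
  by rewrite fin_numD fin_numM// !fin_num_measure//; apply: mpast' => //; exact: measurableC.
- by move=> w _; rewrite lee_fin /F !indicE in_setC; exact: tangent_bound.
Qed.

End past_event_bound.

(** * Events of infinite data sequences *)

Section approximation_by_algebra.
Context d (T : measurableType d) (R : realType).
Context (mu : {measure set T -> \bar R}) (A : set (set T)).
Hypotheses (mufin : (mu setT < +oo)%E) (mA : A `<=` measurable) (A0 : A set0).
Hypotheses (AC : setC_closed A) (AU : setU_closed A).
Local Open Scope ereal_scope.

Let approximable C := forall eps : R, (0 < eps)%R ->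
  exists2 B, A B & mu (C `+` B) < eps%:E.

Let measurable_setY (B C : set T) :
  measurable B -> measurable C -> measurable (B `+` C).
Proof. by move=> mB mC; apply: measurableU; exact: measurableD. Qed.

Let approximable_setU B C : measurable B -> measurable C ->
  approximable B -> approximable C -> approximable (B `|` C).
Proof.
move=> mB mC aB aC eps eps0; have eps20 : (0 < eps / 2)%R by rewrite divr_gt0.
have [B' AB' BB'] := aB _ eps20; have [C' AC' CC'] := aC _ eps20.
exists (B' `|` C'); first exact: AU.
have mB' := mA AB'; have mC' := mA AC'.
apply: (@le_lt_trans _ _ (mu ((B `+` B') `|` (C `+` C')))).
  apply: le_measure; rewrite ?inE.
  - by apply: measurable_setY; exact: measurableU.
  - by apply: measurableU; exact: measurable_setY.
  - by move=> t /=; tauto.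
apply: (le_lt_trans (measureU2 _ _ _)) => //; try exact: measurable_setY.
by rewrite (splitr eps) EFinD lteD.
Qed.

(** The approximable measurable sets form a sigma-algebra containing [A]. A complement has the same
    symmetric differences; a countable union is replaced by a finite one, at a cost of half the
    tolerance, which is then approximated with the other half. *)
Lemma approximation_by_algebra C : <<s A >> C -> approximable C.
Proof.
suff /(_ C) AS : <<s A >> `<=` [set C | measurable C /\ approximable C].
  by move=> /AS[].
apply: smallest_sub; last first.
  move=> B AB; split; first exact: mA.
  move=> eps eps0; exists B => //.
  by rewrite setYK measure0 lte_fin.
split.
- split; first exact: measurable0.
  by move=> eps eps0; exists set0 => //; rewrite setYK measure0 lte_fin.
- move=> B [mB aB]; rewrite setTD; split; first exact: measurableC.
  move=> eps /aB[B' AB' BB']; exists (~` B'); first exact: AC.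
  rewrite (_ : _ `+` _ = B `+` B')//.
  by apply/seteqP; split=> t /=; have [] := pselect (B t);
    have [] := pselect (B' t); tauto.
- move=> F aF; have mF n : measurable (F n) by have [] := aF n.
  have mFU : measurable (\bigcup_n F n) by exact: bigcupT_measurable.
  split=> // eps eps0.
  have eps20 : (0 < eps / 2)%R by rewrite divr_gt0.
  pose G n := \big[setU/set0]_(i < n) F i.
  have aG n : measurable (G n) /\ approximable (G n).
    rewrite /G; elim: n => [|n [mG aG]].
      rewrite big_ord0; split; first exact: measurable0.
      by move=> e e0; exists set0 => //; rewrite setYK measure0 lte_fin.
    rewrite big_ord_recr /=; split; first exact: measurableU.
    by apply: approximable_setU => //; have [] := aF n.
  (* Continuity from above for the remainders, which decrease to the empty set; finiteness of [mu]
     is essential here. *)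
  have cvgG : mu ((\bigcup_n F n) `\` G n) @[n --> \oo] --> mu set0.
    rewrite (_ : set0 = \bigcap_n ((\bigcup_n F n) `\` G n)).
      apply: nonincreasing_cvg_mu => //.
      - apply: le_lt_trans mufin; apply: le_measure; rewrite ?inE//.
        by apply: measurableD => //; have [] := aG 0%N.
      - by move=> n; apply: measurableD => //; have [] := aG n.
      - by apply: bigcapT_measurable => n; apply: measurableD => //; have [] := aG n.
      - move=> m n mn; apply/subsetPset; apply: setDS.
        exact: subset_bigsetU.
    apply/seteqP; split=> // t FG.
    have [[n _ Fnt] _] := FG 0%N I; have [_ []] := FG n.+1 I.
    by rewrite /G -bigcup_mkord; exists n => /=.
  have [n nG] : exists n, mu ((\bigcup_n F n) `\` G n) < (eps / 2)%:E.
    have : \forall n \near \oo, mu ((\bigcup_n F n) `\` G n) < (eps / 2)%:E.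
      apply: (cvgG [set y | y < (eps / 2)%:E]); rewrite measure0.
      exact: (@nbhs_open_ereal_lt R 0%R (cst (eps / 2)%R)).
    by move=> [n _ /(_ n (leqnn n))]; exists n.
  have [mG aGn] := aG n.
  have [B AB GB] := aGn _ eps20; have mB := mA AB.
  exists B => //.
  apply: (@le_lt_trans _ _ (mu (((\bigcup_n F n) `\` G n) `|` (G n `+` B)))).
    apply: le_measure; rewrite ?inE.
    - exact: measurable_setY.
    - by apply: measurableU; [exact: measurableD|exact: measurable_setY].
    - have GF : G n `<=` \bigcup_n F n.
        by rewrite /G -bigcup_mkord => t [i _ Fit]; exists i.
      move=> t /= [[Ft Bt]|[Bt Ft]]; first by have [|] := pselect (G n t); tauto.
      by right; right; split=> // /GF.
  apply: (le_lt_trans (measureU2 _ _ _)) => //.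
  - exact: measurableD.
  - exact: measurable_setY.
  by rewrite (splitr eps) EFinD lteD.
Qed.

End approximation_by_algebra.

Section event_bound.
Context (R : realType) (E : finType).

(** The generator inside [data_measurable], named so that sequences of records become a measurable
    type with exactly these events. *)
Definition record_coordinate_event : set (set (nat -> record R E)) :=
  [set C | exists j (B : set (record R E)), measurable B /\ C = [set r | B (r j)]].

Local Notation records := (g_sigma_algebraType record_coordinate_event).

Definition cylinder : set (set (nat -> record R E)) :=
  [set C | exists j (B : set (j.-tuple (record R E))),
    measurable B /\ C = [set r : nat -> record R E | B [tuple r i | i < j]]].

Lemma measurable_coordinate j : measurable_fun setT (fun r : records => r j).
Proof.
by move=> _ B mB; rewrite setTI; apply: sub_sigma_algebra; exists j, B.
Qed.

Lemma measurable_prefix j :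
  measurable_fun setT (fun r : records => [tuple r i | i < j]).
Proof.
apply/measurable_fun_tnthP => i.
rewrite (_ : _ \o _ = fun r : records => r i); first exact: measurable_coordinate.
by apply/funext => w; rewrite /= tnth_mktuple.
Qed.

Lemma cylinder_measurable : cylinder `<=` @measurable _ records.
Proof.
move=> _ [j [B [mB ->]]]; rewrite -[X in measurable X]setTI.
exact: measurable_prefix.
Qed.

Lemma cylinder0 : cylinder set0.
Proof. by exists 0%N, set0; split; first exact: measurable0. Qed.

Lemma cylinderC : setC_closed cylinder.
Proof.
by move=> _ [j [B [mB ->]]]; exists j, (~` B); split; first exact: measurableC.
Qed.

(** Brings two cylinders to a common length, as closure under union requires. *)
Lemma cylinder_widen j k (B : set (j.-tuple (record R E))) :
  measurable B -> (j <= k)%N -> exists2 B' : set (k.-tuple (record R E)),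
    measurable B' &
    [set r : nat -> record R E | B [tuple r i | i < j]] =
    [set r : nat -> record R E | B' [tuple r i | i < k]].
Proof.
move=> mB jk.
pose f (h : k.-tuple (record R E)) := [tuple tnth h (widen_ord jk i) | i < j].
have mf : measurable_fun setT f.
  apply/measurable_fun_tnthP => i.
  rewrite (_ : _ \o _ = fun h => tnth h (widen_ord jk i)); last first.
    by apply/funext => h; rewrite /= tnth_mktuple.
  exact: measurable_tnth.
exists (f @^-1` B); first by rewrite -[X in measurable X]setTI; exact: mf.
apply/seteqP; split=> r /=; suff -> : f [tuple r i | i < k] = [tuple r i | i < j] by [].
  by apply: eq_from_tnth => i; rewrite !tnth_mktuple.
by apply: eq_from_tnth => i; rewrite !tnth_mktuple.
Qed.

Lemma cylinderU : setU_closed cylinder.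
Proof.
move=> _ _ [j [B [mB ->]]] [k [C [mC ->]]].
have [B' mB' ->] := cylinder_widen mB (leq_maxl j k).
have [C' mC' ->] := cylinder_widen mC (leq_maxr j k).
by exists (maxn j k), (B' `|` C'); split; first exact: measurableU.
Qed.

Lemma data_measurable_cylinder : @data_measurable R E `<=` <<s cylinder >>.
Proof.
apply: smallest_sub; first exact: smallest_sigma_algebra.
move=> _ [j [B [mB ->]]]; apply: sub_sigma_algebra.
exists j.+1, [set h | B (tnth h ord_max)]; split.
  by rewrite -[X in measurable X]setTI; exact: measurable_tnth.
by apply/seteqP; split=> r /=; rewrite tnth_mktuple.
Qed.

Definition records_of (x : E -> R) (proc : procedure R E)
  (X : experiment x proc) (w : Defs.space X) : records := fun j => data X j w.

Global Arguments records_of {x proc} X w.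

Lemma measurable_records_of (x : E -> R) (proc : procedure R E)
    (X : experiment x proc) : measurable_fun setT (records_of X).
Proof.
apply: (measurability _ (erefl (@measurable _ records))).
move=> _ [_ [j [B [mB ->]]] <-]; rewrite setTI.
by rewrite -[X in measurable X]setTI; exact: measurable_data.
Qed.

End event_bound.

Section data_event_bound.
Context (R : realType) (E : finType) (x x' : E -> R) (proc : procedure R E).
Context (X : experiment x proc) (X' : experiment x' proc).
Local Notation records := (g_sigma_algebraType (@record_coordinate_event R E)).
Local Open Scope ereal_scope.

Let law_records (y : E -> R) (Y : experiment y proc) :
  {measure set records -> \bar R}.
Proof.
by refine (pushforward (law Y) (records_of Y)); exact: measurable_records_of.
Defined.

Let mrecords (y : E -> R) (Y : experiment y proc) (C : set records) :
  measurable C -> measurable (records_of Y @^-1` C).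
Proof. by move=> mC; rewrite -[X in measurable X]setTI; exact: measurable_records_of. Qed.

Let law_fin (y : E -> R) (Y : experiment y proc) (C : set records) :
  measurable C -> law Y (records_of Y @^-1` C) \is a fin_num.
Proof. by move=> mC; apply: fin_num_measure; exact: mrecords. Qed.

Let law_setY (y : E -> R) (Y : experiment y proc) (B C : set records) (e : R) :
  measurable B -> measurable C -> law Y (records_of Y @^-1` (B `+` C)) < e%:E ->
  (fine (law Y (records_of Y @^-1` B)) <= fine (law Y (records_of Y @^-1` C)) + e)%R.
Proof.
move=> mB mC BCe; have mBC : measurable (B `+` C) by apply: measurableU; exact: measurableD.
rewrite -lee_fin EFinD !fineK ?law_fin//.
apply: (@le_trans _ _ (law Y (records_of Y @^-1` C) +
  law Y (records_of Y @^-1` (B `+` C)))).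
  apply: le_trans (measureU2 _ _ _); try exact: mrecords.
  apply: le_measure; rewrite ?inE; try exact: mrecords.
    by apply: measurableU; exact: mrecords.
  by move=> w /= Bw; have [Cw|Cw] := pselect (C (records_of Y w)); tauto.
by rewrite leeD2l// ltW.
Qed.

Lemma cylinder_event_bound (C : set records) (c D : R) : cylinder C -> (0 <= c)%R ->
  (forall j, \sum_(i < j) drift_energy x' X i <= D%:E) ->
  (expR (- c) * (c * fine (law X (records_of X @^-1` C)) - D) <=
   fine (law X' (records_of X' @^-1` C)))%R.
Proof.
move=> cC c0 DX; have mC := cylinder_measurable cC.
case: cC mC => j [B [mB ->]] mC.
have Dfin i : drift_energy x' X i < +oo.
  apply: (le_lt_trans _ (ltry D)); apply: le_trans (DX i.+1).
  rewrite big_ord_recr /= leeDr//; apply: sume_ge0 => k _; exact: drift_energy_ge0.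
have := past_event_bound X' c mB (fun i _ => Dfin i).
have pastE (y : E -> R) (Y : experiment y proc) (B' : set _) :
  past (data Y) j @^-1` B' =
  records_of Y @^-1` [set r : records | B' [tuple r i | i < j]] by [].
rewrite !pastE.
set P := law X _; set P' := law X' _; set Q := law X' _; set S := \sum_(_ < _) _.
move=> bound.
have Pf : P \is a fin_num by exact: law_fin.
have P'f : P' \is a fin_num by exact: law_fin.
have Sf : S \is a fin_num.
  rewrite ge0_fin_numE; last by apply: sume_ge0 => k _; exact: drift_energy_ge0.
  exact: le_lt_trans (DX j) (ltry D).
have SD : (fine S <= D)%R by rewrite -lee_fin fineK//; exact: DX.
(* The complement has probability at most 1 under [X'], so its term is absorbed by the constant 1 on
   the left of the bound. *)
have Q1 : Q <= 1.
  by apply: probability_le1; apply: mrecords; exact: measurableC mC.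
have Qf : Q \is a fin_num.
  exact: (law_fin X' (measurableC mC)).
have {}Q1 : (fine Q <= 1)%R by rewrite -lee_fin fineK//.
move: bound; rewrite -(fineK Pf) -(fineK P'f) -(fineK Sf) -(fineK Qf).
rewrite -!EFinM -!EFinD. rewrite lee_fin /=.
have := expR_gt0 (- c); set e := expR (- c); nra.
Qed.

(* Cylinder events are handled by a finite horizon; approximating an arbitrary
   event by a cylinder simultaneously under both laws loses nothing, since the
   bound [D] does not depend on the horizon. *)
Lemma event_bound (C : set (nat -> record R E)) (c D : R) :
  @data_measurable R E C -> (0 <= c)%R ->
  (forall j, \sum_(i < j) drift_energy x' X i <= D%:E) ->
  (expR (- c) * (c * fine (law X (records_of X @^-1` C)) - D) <=
   fine (law X' (records_of X' @^-1` C)))%R.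
Proof.
move=> mC c0 DX.
have mC' : measurable (C : set records) := mC.
apply/ler_addgt0Pr => e e0.
(* An approximation error t costs exp(-c) c t when [C] is replaced by [B] under [X], and t when [B]
   is replaced by [C] under [X']. Approximating for the sum of the two laws controls both errors
   with one cylinder. *)
pose K := (1 + expR (- c) * c)%R.
have K0 : (0 < K)%R by rewrite ltr_pwDl// mulr_ge0 ?expR_ge0.
have eK0 : (0 < e / K)%R by rewrite divr_gt0.
have mufin : measure_add (law_records X) (law_records X') setT < +oo.
  have -> : measure_add (law_records X) (law_records X') setT =
    law_records X setT + law_records X' setT by exact: measure_addE.
  by rewrite lte_add_pinfty// -ge0_fin_numE//; exact: law_fin.
have [B cB] := approximation_by_algebra mufin (@cylinder_measurable R E)
  (@cylinder0 R E) (@cylinderC R E) (@cylinderU R E)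
  (@data_measurable_cylinder R E _ mC) eK0.
have mB := cylinder_measurable cB.
have mCB : measurable ((C : set records) `+` B) by apply: measurableU; exact: measurableD.
move=> CBe.
have {}CBe : law_records X ((C : set records) `+` B) +
  law_records X' ((C : set records) `+` B) < (e / K)%:E by rewrite -measure_addE.
have CB : (fine (law X (records_of X @^-1` C)) <=
  fine (law X (records_of X @^-1` B)) + e / K)%R.
  apply: law_setY => //; apply: le_lt_trans CBe.
  by apply: leeDl; exact: measure_ge0.
have BC : (fine (law X' (records_of X' @^-1` B)) <=
  fine (law X' (records_of X' @^-1` C)) + e / K)%R.
  apply: law_setY => //; rewrite setYC; apply: le_lt_trans CBe.
  by apply: leeDr; exact: measure_ge0.
have bound := cylinder_event_bound cB c0 DX.
have -> : (e = K * (e / K))%R by rewrite mulrC divfK// gt_eqF.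
have ec : (0 <= expR (- c) * c)%R by rewrite mulr_ge0 ?expR_ge0.
have := ler_wpM2l ec CB.
move: (e / K)%R BC => t BC; rewrite /K; lra.
Qed.

End data_event_bound.

(** * Precision and error *)

Section precision_split.
Context (R : realType) (E : finType) (x : E -> R) (proc : procedure R E).
Context (X : experiment x proc).
Local Open Scope ereal_scope.

Definition precision_on (A : {set E}) (a : decision R E) : R :=
  if a is Some (i, g) then if i \in A then g else 0%R else 0%R.

Definition expected_precision_on (A : {set E}) : \bar R :=
  \sum_(0 <= j <oo) \int[law X]_w (precision_on A (decide X j w))%:E.

Lemma measurable_precision_on (A : {set E}) : measurable_fun setT (precision_on A).
Proof.
apply: measurable_fun_slot => i /=.
by case: (i \in A); [exact: measurable_id|exact: measurable_cst].
Qed.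

Lemma precision_on_decide_ge0 (A : {set E}) j w :
  (0 <= precision_on A (decide X j w))%R.
Proof.
case Ew : (decide X j w) => [[i g]|] //=; case: ifP => // _.
by apply/ltW; exact: decide_precision_gt0 Ew.
Qed.

Let mprec A j :
  measurable_fun setT (fun w => (precision_on A (decide X j w))%:E : \bar R).
Proof.
apply/measurable_EFinP; apply: (measurableT_comp (measurable_precision_on A)).
exact: measurable_decide.
Qed.

Lemma expected_precision_on_ge0 A : 0 <= expected_precision_on A.
Proof.
apply: nneseries_ge0 => j _ _; apply: integral_ge0 => w _.
by rewrite lee_fin precision_on_decide_ge0.
Qed.

Lemma expected_precision_onT : expected_precision_on [set: E]%SET = expected_precision X.
Proof.
rewrite /expected_precision_on -integral_nneseries//; last first.
  by move=> j w _; rewrite lee_fin precision_on_decide_ge0.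
apply: eq_integral => w _; apply: eq_eseriesr => j _.
by case: (decide X j w) => [[i g]|] //=; rewrite inE.
Qed.

(** A measured coordinate lies in at most one member of a disjoint family, so its precision is
    counted at most once. *)
Lemma sum_precision_on (F : {set {set E}}) (a : decision R E) :
  (forall i g, a = Some (i, g) -> 0 < g)%R -> finset.trivIset F ->
  (\sum_(A in F) precision_on A a <= precision_on [set: E]%SET a)%R.
Proof.
case: a => [[i g]|] /= gt0 tF; last by rewrite big1.
rewrite inE; have g0 := ltW (gt0 i g erefl).
have [iF|iF] := boolP (i \in finset.cover F); last first.
  rewrite big1// => A AF; case: ifPn => // iA; case/negP: iF.
  by apply/bigcupP; exists A.
have [A AF iA] := bigcupP iF.
rewrite (bigD1 A)//= iA big1 ?addr0// => B /andP[BF BA].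
case: ifPn => // iB; have := finset.trivIsetP tF _ _ BF AF BA.
by move=> /disjoint_setI0/setP/(_ i); rewrite !inE iB iA.
Qed.

Lemma sum_expected_precision_on (F : {set {set E}}) : finset.trivIset F ->
  \sum_(A in F) expected_precision_on A <= expected_precision X.
Proof.
move=> tF; rewrite -expected_precision_onT.
have i0 A j : 0 <= \int[law X]_w (precision_on A (decide X j w))%:E.
  by apply: integral_ge0 => w _; rewrite lee_fin precision_on_decide_ge0.
rewrite /expected_precision_on -nneseries_sum//.
apply: lee_nneseries => [j _ _|j _]; first exact: sume_ge0.
rewrite -big_enum /= -ge0_integral_sum//; last first.
  by move=> A w _; rewrite lee_fin precision_on_decide_ge0.
apply: ge0_le_integral => //.
- move=> w _; apply: sume_ge0 => A _.
  by rewrite lee_fin precision_on_decide_ge0.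
- exact: emeasurable_sum.
- move=> w _; rewrite big_enum sumEFin lee_fin; apply: sum_precision_on => //.
  by move=> i g; exact: decide_precision_gt0.
Qed.

End precision_split.

Section signal_energy.
Context (R : realType) (E : finType) (mu : R) (S A : {set E}).
Context (proc : procedure R E) (X : experiment (signal mu S) proc).
Hypothesis SA : [disjoint S & A]%B.
Local Open Scope ereal_scope.

(** The two signals differ by [mu] on [A] and agree elsewhere, so a step contributes its precision
    exactly when it measures [A]. Bounding the partial sum by the whole series removes the
    dependence on [j]. *)
Lemma sum_drift_energy_signal j :
  \sum_(i < j) drift_energy (signal mu (S :|: A)) X i <=
  (mu ^+ 2 / 2)%:E * expected_precision_on X A.
Proof.
have energyE i : drift_energy (signal mu (S :|: A)) X i =
    (mu ^+ 2 / 2)%:E * \int[law X]_w (precision_on A (decide X i w))%:E.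
  rewrite -ge0_integralZl//; last 3 first.
  - apply/measurable_EFinP; apply: (measurableT_comp (measurable_precision_on A)).
    exact: measurable_decide.
  - by move=> w _; rewrite lee_fin precision_on_decide_ge0.
  - by rewrite lee_fin divr_ge0// sqr_ge0.
  apply: eq_integral => w _; rewrite -EFinM; congr (_%:E).
  case Ew : (decide X i w) => [[e g]|] /=; last by rewrite expr0n/= mul0r mulr0.
  have g0 : (0 <= g)%R by apply/ltW; exact: decide_precision_gt0 Ew.
  rewrite exprMn sqr_sqrtr// /signal inE.
  have [eA|eA] := boolP (e \in A); last by rewrite orbF subrr expr0n/= !(mul0r, mulr0).
  have -> : (e \in S) = false.
    by apply/negP => eS; have /disjoint_setI0/setP/(_ e) := SA; rewrite !inE eS eA.
  by rewrite /= sub0r sqrrN; ring.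
under eq_bigr do rewrite energyE.
rewrite -ge0_sume_distrr; last first.
  move=> i _; apply: integral_ge0 => w _; by rewrite lee_fin precision_on_decide_ge0.
rewrite lee_wpmul2l ?lee_fin ?divr_ge0 ?sqr_ge0//.
rewrite -(big_mkord xpredT (fun i => \int[law X]_w (precision_on A (decide X i w))%:E)).
apply: nneseries_lim_ge => i _ _; apply: integral_ge0 => w _.
by rewrite lee_fin precision_on_decide_ge0.
Qed.

End signal_energy.

Section estimation_error.
Context (R : realType) (E : finType) (x : E -> R) (proc : procedure R E).
Context (X : experiment x proc) (est : estimator R E).
Local Notation records := (g_sigma_algebraType (@record_coordinate_event R E)).
Local Open Scope ereal_scope.

Definition missed (e : E) : set (nat -> record R E) := [set r | e \notin est r].

Definition miss_probability (e : E) : R := fine (law X (records_of X @^-1` missed e)).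

Lemma data_measurable_missed e : @data_measurable R E (missed e).
Proof.
rewrite (_ : missed e =
    \bigcup_(Z in [set Z : {set E} | e \notin Z]) [set r | est r = Z]).
  apply: (@fin_bigcup_measurable _ records); first exact: finite_finset.
  by move=> Z _; exact: measurable_estimate.
by apply/seteqP; split=> [r er|r [Z eZ rZ]]; [exists (est r)|rewrite /missed /= rZ].
Qed.

Let measurable_missed_event e : measurable (records_of X @^-1` missed e).
Proof.
rewrite -[X in measurable X]setTI.
by apply: measurable_records_of => //; exact: data_measurable_missed.
Qed.

Let law_missed e : law X (records_of X @^-1` missed e) = (miss_probability e)%:E.
Proof. by rewrite fineK// fin_num_measure. Qed.

Lemma expected_errorE (S : {set E}) : expected_error X est S =
  (\sum_(e in S) miss_probability e +
   \sum_(e in ~: S) (1 - miss_probability e))%:E.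
Proof.
(* The event that [e] is misclassified; the size of the symmetric difference is the sum of these
   indicators. *)
pose B e := if e \in S then records_of X @^-1` missed e
            else ~` (records_of X @^-1` missed e).
have mB e : measurable (B e).
  by rewrite /B; case: ifP => _ //; exact: measurableC.
rewrite /expected_error.
transitivity (\int[law X]_w \sum_(e : E) (\1_(B e) w)%:E).
  apply: eq_integral => w _; rewrite sumEFin; congr (_%:E).
  rewrite -sum1_card natr_sum [RHS](eq_bigr (fun e =>
    if e \in symdiff (est (fun j => data X j w)) S then 1 else 0)%R).
    by rewrite -big_mkcond.
  move=> e _; rewrite indicE /B /symdiff !finset.inE.
  have missE : (w \in records_of X @^-1` missed e) = (e \notin est (fun j => data X j w)).
    by apply/idP/idP => [/set_mem|?]; last exact: mem_set.
  by case: (e \in S); rewrite ?in_setC missE; case: (e \in est _).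
rewrite ge0_integral_sum//; last first.
  by move=> e; apply/measurable_EFinP; exact: measurable_indic.
rewrite (bigID (mem S)) /= EFinD -!sumEFin; congr (_ + _).
  by apply: eq_bigr => e eS; rewrite integral_indic// setIT /B eS; exact: law_missed.
rewrite [RHS](eq_bigl (fun e => e \notin S)); last by move=> e; rewrite finset.in_setC.
apply: eq_bigr => e eS. rewrite integral_indic// setIT /B (negbTE eS).
by rewrite EFinB -law_missed; exact: probability_setC.
Qed.

End estimation_error.

(** * Star packings *)

Section double_counting.
Context (R : realType) (I : finType) (F : {set I}).

Definition subfamilies k : {set {set I}} :=
  [set T : {set I} | (T \subset F) && (#|T| == k)]%SET.

(* (T, A) |-> (A |: T, A) is a bijection between pairs with A outside T and
   pairs with A inside the family. *)
Lemma sum_subfamilies_add k (g : {set I} -> I -> R) : (0 < k)%N ->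
  \sum_(T in subfamilies k.-1) \sum_(A in F :\: T) g (A |: T) A =
  \sum_(T in subfamilies k) \sum_(A in T) g T A.
Proof.
move=> k0; rewrite !pair_big_dep /=.
rewrite [RHS](reindex_onto (fun p : {set I} * I => (p.2 |: p.1, p.2))
  (fun p : {set I} * I => (p.1 :\ p.2, p.2))) /=; last first.
  by move=> [T A] /= /andP[_ AT]; rewrite finset.setD1K.
apply: eq_bigl => -[T A] /=; rewrite !finset.inE eqxx orTb andbT.
apply/idP/idP => [/and3P[/andP[TF /eqP cT] AT AF]|/andP[/andP[ATF cAT] /eqP[TA]]].
  rewrite finset.subUset finset.sub1set AF TF cardsU1 AT cT add1n prednK// eqxx /=.
  by rewrite finset.setU1K.
have AT : A \notin T by rewrite -TA !finset.inE eqxx.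
move: ATF cAT; rewrite finset.subUset finset.sub1set cardsU1 AT add1n => /andP[AF TF] /eqP <-.
by rewrite AF TF eqxx.
Qed.

Lemma card_subfamilies k : #|subfamilies k| = 'C(#|F|, k).
Proof. by rewrite /subfamilies cards_draws. Qed.

End double_counting.

Section star_packings.
Context (p s : nat).

Lemma star_packingS (F T : {set {set edge p}}) :
  T \subset F -> star_packing s F -> star_packing s T.
Proof.
move=> /fintype.subsetP TF /andP[/forall_inP sF /forall_inP dF]; apply/andP; split.
  by apply/forall_inP => A /TF; exact: sF.
apply/forall_inP => A AT; apply/forall_inP => B BT.
by have /forall_inP := dF A (TF _ AT); apply; exact: TF.
Qed.

Lemma star_packing_trivIset (F : {set {set edge p}}) :
  star_packing s F -> finset.trivIset F.
Proof.
move=> /andP[_ /forall_inP dF]; apply/finset.trivIsetP => A B AF BF AB.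
by have /forall_inP/(_ B BF)/implyP := dF A AF; exact.
Qed.

Lemma star_packing_card (F : {set {set edge p}}) A :
  star_packing s F -> A \in F -> #|A| = s.
Proof. by move=> /andP[/forall_inP sF _] /sF/andP[/eqP]. Qed.

Lemma max_stars_packing : exists2 F : {set {set edge p}},
  star_packing s F & #|F| = max_stars p s.
Proof.
rewrite /max_stars; have p0 : star_packing s (finset.set0 : {set {set edge p}}).
  by apply/andP; split; apply/forall_inP => A; rewrite finset.inE.
rewrite (bigop.bigmax_eq_arg finset.set0)//; case: arg_maxnP => // F pF _.
by exists F.
Qed.

Lemma star_unions_cover k (F T : {set {set edge p}}) :
  star_packing s F -> T \subset F -> (#|T| == k) || (#|T| == k.-1) ->
  finset.cover T \in star_unions p s k.
Proof.
move=> pF TF cT; rewrite finset.inE; apply/existsP; exists T.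
by rewrite (star_packingS TF pF) cT eqxx.
Qed.

Lemma cover_disjoint (F T : {set {set edge p}}) A :
  star_packing s F -> T \subset F -> A \in F :\: T ->
  [disjoint finset.cover T & A]%B.
Proof.
move=> /star_packing_trivIset/finset.trivIsetP tF /fintype.subsetP TF.
rewrite finset.inE => /andP[AT AF]; rewrite disjoint_sym /finset.cover.
apply: finset.bigcup_disjoint => B BT; apply: tF => //; first exact: TF.
by apply: contraNneq AT => ->.
Qed.

Lemma cover_setU1 (T : {set {set edge p}}) A :
  finset.cover (A |: T) = finset.cover T :|: A.
Proof. by rewrite /finset.cover finset.bigcup_setU big_set1 finset.setUC. Qed.

End star_packings.

(** * Averaging over the subfamilies of a packing *)

Section miss_bound.
Context (R : realType) (E : finType) (mu c : R) (S S' A : {set E}).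
Context (proc : procedure R E) (est : estimator R E).
Context (X : experiment (signal mu S) proc) (X' : experiment (signal mu S') proc).

Lemma miss_probability_bounds e : 0 <= miss_probability X est e <= 1.
Proof.
have mm : measurable (records_of X @^-1` missed est e).
  rewrite -[Y in measurable Y]setTI.
  by apply: measurable_records_of => //; exact: data_measurable_missed.
rewrite /miss_probability fine_ge0//=.
rewrite -lee_fin fineK ?fin_num_measure//; exact: probability_le1.
Qed.

(** The larger support is given by an equation because the type of [X'] depends on it: the bound can
    then be used at [cover (A |: T)] without transporting the experiment. *)
Lemma miss_bound e : S' = S :|: A -> [disjoint S & A]%B -> 0 <= c ->
  (expected_precision_on X A < +oo)%E ->
  expR (- c) * (c * miss_probability X est e -
                mu ^+ 2 / 2 * fine (expected_precision_on X A)) <=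
  miss_probability X' est e.
Proof.
move=> S'E SA c0 Qfin; apply: event_bound => //; first exact: data_measurable_missed.
move=> j; rewrite S'E EFinM fineK; first exact: sum_drift_energy_signal.
by rewrite ge0_fin_numE// expected_precision_on_ge0.
Qed.

End miss_bound.

Section packing_bound.
Context (R : realType) (p s k : nat) (m mu eps : R).
Context (proc : procedure R (edge p)) (est : estimator R (edge p)).
Context (X : forall S : {set edge p}, experiment (signal mu S) proc).
Hypothesis budget : forall S : {set edge p}, S \in star_unions p s k ->
  (expected_precision (X S) <= m%:E)%E.
Hypothesis risk : forall S : {set edge p}, S \in star_unions p s k ->
  (expected_error (X S) est S <= eps%:E)%E.
Context (F : {set {set edge p}}).
Hypothesis pF : star_packing s F.

Let miss T e := miss_probability (X (finset.cover T)) est e.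
Let miss_ge0 T e : 0 <= miss T e.
Proof. by have /andP[] := miss_probability_bounds est (X (finset.cover T)) e. Qed.
Let hit_ge0 T e : 0 <= 1 - miss T e.
Proof.
have /andP[_] := miss_probability_bounds est (X (finset.cover T)) e.
by rewrite subr_ge0.
Qed.

Let riskE (T : {set {set edge p}}) : T \subset F -> (#|T| == k) || (#|T| == k.-1) ->
  \sum_(e in finset.cover T) miss T e + \sum_(e in ~: finset.cover T) (1 - miss T e) <= eps.
Proof.
move=> TF cT; have := risk (star_unions_cover pF TF cT).
by rewrite expected_errorE lee_fin.
Qed.

Lemma sum_miss_le (T : {set {set edge p}}) : T \in subfamilies F k ->
  \sum_(A in T) \sum_(e in A) miss T e <= eps.
Proof.
rewrite finset.inE => /andP[TF cT].
rewrite -finset.big_trivIset; last by apply: (star_packing_trivIset (star_packingS TF pF)).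
by apply: le_trans (riskE TF _); rewrite ?cT// lerDl sumr_ge0.
Qed.

(** The remaining N - k + 1 stars have s edges each, all outside the support, so every one of these
    edges that is not missed is a false discovery paid for by the risk. *)
Lemma sum_miss_ge (T : {set {set edge p}}) :
  (0 < k)%N -> (k <= #|F|)%N -> T \in subfamilies F k.-1 ->
  s%:R * (#|F|%:R - k%:R + 1) - eps <=
  \sum_(A in F :\: T) \sum_(e in A) miss T e.
Proof.
move=> k0 kF; rewrite finset.inE => /andP[TF cT].
have FTpack : star_packing s (F :\: T) by apply: star_packingS pF; exact: finset.subsetDl.
have -> : s%:R * (#|F|%:R - k%:R + 1) = \sum_(A in F :\: T) \sum_(e in A) 1 :> R.
  rewrite (eq_bigr (fun=> s%:R)) => [|A AFT]; last first.
    by rewrite sumr_const (star_packing_card FTpack AFT).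
  rewrite sumr_const cardsDS// (eqP cT) -[RHS]mulr_natr.
  rewrite natrB; last by rewrite (leq_trans (leq_pred k)).
  by rewrite -{1}(prednK k0) -[k.-1.+1]addn1 natrD; congr (_ * _); ring.
rewrite lerBlDr -lerBlDl -sumrB.
under eq_bigr do rewrite -sumrB.
rewrite -finset.big_trivIset; last exact: star_packing_trivIset FTpack.
apply: le_trans (riskE TF _); last by rewrite cT orbT.
have sub : finset.cover (F :\: T) \subset ~: finset.cover T.
  rewrite -finset.disjoints_subset disjoint_sym /finset.cover.
  apply: finset.bigcup_disjoint => A AFT.
  exact: cover_disjoint pF TF AFT.
rewrite [X in _ + X](bigID (mem (finset.cover (F :\: T)))) /=.
rewrite [X in _ + (X + _)](eq_bigl (mem (finset.cover (F :\: T)))); last first.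
  move=> e; apply/andP/idP => [[]//|eFT]; split=> //.
  exact: (fintype.subsetP sub).
by rewrite addrCA lerDl addr_ge0 ?sumr_ge0.
Qed.

(** All added stars are compared with the one law at [cover T], whose budget is therefore spent once
    for all of them. The factor [s] before the energy appears because each edge of [A] is charged
    the full cost of [A]. *)
Lemma sum_shift_miss_ge (c : R) (T : {set {set edge p}}) :
  0 <= c -> (0 < k)%N -> (k <= #|F|)%N -> T \in subfamilies F k.-1 ->
  expR (- c) * (c * (s%:R * (#|F|%:R - k%:R + 1) - eps) -
                s%:R * (mu ^+ 2 * m / 2)) <=
  \sum_(A in F :\: T) \sum_(e in A) miss (A |: T) e.
Proof.
move=> c0 k0 kF Tk; have := sum_miss_ge k0 kF Tk.
move: Tk; rewrite finset.inE => /andP[TF cT].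
pose Q A := fine (expected_precision_on (X (finset.cover T)) A).
have FTpack : star_packing s (F :\: T) by apply: star_packingS pF; exact: finset.subsetDl.
have sumQ : (\sum_(A in F :\: T) expected_precision_on (X (finset.cover T)) A <= m%:E)%E.
  apply: le_trans (budget (star_unions_cover pF TF _)); last by rewrite cT orbT.
  by apply: sum_expected_precision_on; exact: star_packing_trivIset FTpack.
have Qfin A : A \in F :\: T -> (expected_precision_on (X (finset.cover T)) A < +oo)%E.
  move=> AFT; apply: le_lt_trans (ltry m); apply: le_trans sumQ.
  rewrite (bigD1 A)//= leeDl// sume_ge0// => B _; exact: expected_precision_on_ge0.
have {}sumQ : \sum_(A in F :\: T) Q A <= m.
  rewrite -lee_fin -sumEFin; apply: le_trans sumQ; apply: lee_sum => A AFT.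
  by rewrite fineK// ge0_fin_numE ?Qfin// expected_precision_on_ge0.
move=> missT.
apply: (@le_trans _ _ (\sum_(A in F :\: T) \sum_(e in A)
    (expR (- c) * (c * miss T e - mu ^+ 2 / 2 * Q A)))); last first.
  apply: ler_sum => A AFT; apply: ler_sum => e eA.
  apply: (miss_bound est (X (finset.cover (A |: T))) e (cover_setU1 T A)) => //.
  - exact: cover_disjoint pF TF AFT.
  - exact: Qfin.
have -> : \sum_(A in F :\: T) \sum_(e in A)
    (expR (- c) * (c * miss T e - mu ^+ 2 / 2 * Q A)) =
  expR (- c) * (c * (\sum_(A in F :\: T) \sum_(e in A) miss T e) -
    s%:R * (mu ^+ 2 / 2 * \sum_(A in F :\: T) Q A)).
  rewrite !mulr_sumr -sumrB mulr_sumr; apply: eq_bigr => A AFT.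
  rewrite -mulr_sumr; congr (_ * _); rewrite sumrB -mulr_sumr; congr (_ - _).
  by rewrite sumr_const (star_packing_card FTpack AFT) mulr_natl.
rewrite ler_pM2l ?expR_gt0//; apply: lerB; first exact: ler_wpM2l.
by rewrite [mu ^+ 2 * m / 2]mulrAC !ler_wpM2l// divr_ge0// sqr_ge0.
Qed.

Lemma packing_bound (c : R) : 0 <= c -> (0 < k)%N -> (k <= #|F|)%N ->
  k%:R * (expR (- c) * (c * (s%:R * (#|F|%:R - k%:R + 1) - eps) -
                        s%:R * (mu ^+ 2 * m / 2))) <=
  (#|F|%:R - k%:R + 1) * eps.
Proof.
move=> c0 k0 kF; set b := expR _ * _.
have lb : #|subfamilies F k.-1|%:R * b <= #|subfamilies F k|%:R * eps.
  apply: (@le_trans _ _ (\sum_(T in subfamilies F k.-1)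
      \sum_(A in F :\: T) \sum_(e in A) miss (A |: T) e)).
    rewrite mulr_natl -sumr_const; apply: ler_sum => T Tk.
    exact: sum_shift_miss_ge.
  rewrite (sum_subfamilies_add F (fun T A => \sum_(e in A) miss T e) k0).
  by rewrite mulr_natl -sumr_const; apply: ler_sum => T Tk; exact: sum_miss_le.
have n1_gt0 : (0 < #|subfamilies F k.-1|%:R :> R).
  by rewrite ltr0n card_subfamilies bin_gt0 (leq_trans (leq_pred k)).
(* This ratio of consecutive binomial coefficients is the source of the term log k in the
   theorem. *)
have kE : k%:R * #|subfamilies F k|%:R =
    (#|F|%:R - k%:R + 1) * #|subfamilies F k.-1|%:R :> R.
  rewrite !card_subfamilies -natrM -{1 2}(prednK k0) mul_bin_left natrM natrB.
    by rewrite -{3}(prednK k0) -[k.-1.+1]addn1 natrD; ring.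
  exact: leq_trans (leq_pred k) kF.
rewrite -(ler_pM2r n1_gt0) -mulrA (mulrC b) mulrAC -kE -mulrA.
by rewrite ler_wpM2l// mulrC.
Qed.

End packing_bound.

(** The square of exp(-1/2) >= 1/2. It pays for the extra 1 in the choice of [c]. *)
Lemma expRN1_ge (R : realType) : 4^-1 <= expR (- 1) :> R.
Proof.
have := expR_ge1Dx (- 2^-1 : R); have : expR (- 2^-1) * expR (- 2^-1) = expR (- 1) :> R.
  by rewrite -expRD; congr expR; field.
by move=> <-; nra.
Qed.

Theorem proposition17 (R : realType) (p s k : nat) (m mu eps : R)
  (hp : (2 <= p)%N) (hs : (1 <= s <= p.-1)%N) (hk : (1 <= k)%N)
  (hN : (k < max_stars p s)%N) (hm : 0 < m) (hmu : 0 < mu)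
  (heps : 0 < eps < 1)
  (proc : procedure R (edge p)) (est : estimator R (edge p))
  (X : forall S : {set edge p}, experiment (signal mu S) proc)
  (hbudget : forall S : {set edge p}, S \in star_unions p s k ->
     (expected_precision (X S) <= m%:E)%E)
  (hrisk : forall S : {set edge p}, S \in star_unions p s k ->
     (expected_error (X S) est S <= eps%:E)%E) :
  let N : R := (max_stars p s)%:R in
  Num.sqrt (2 * (N - k%:R) / m *
            (ln k%:R + ln ((N - k%:R) / (N + 1)) + ln (s%:R / (8 * eps))))
  <= mu.
Proof.
cbv zeta; set N : R := (max_stars p s)%:R.
have [F pF cF] := max_stars_packing p s.
have /andP[eps0 eps1] := heps; have /andP[s1 _] := hs.
have k0 : 1 <= k%:R :> R by rewrite ler1n.
have s0 : 1 <= s%:R :> R by rewrite ler1n.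
have n0 : 0 < N - k%:R by rewrite subr_gt0 ltr_nat.
set n := N - k%:R in n0 *.
have N0 : 0 < N + 1 by rewrite ltr_wpDl.
(* Solving for [mu] shows that the claim amounts to the sum of logarithms being at most [a]. *)
pose a := mu ^+ 2 * m / (2 * n).
have aE : a * n = mu ^+ 2 * m / 2 by rewrite /a; field; rewrite gt_eqF.
have a0 : 0 <= a by rewrite divr_ge0 ?mulr_ge0 ?sqr_ge0// ltW.
have := packing_bound hbudget hrisk pF (addr_ge0 a0 ler01) hk.
rewrite cF => /(_ (ltnW hN)); rewrite -/N -/n => bound.
(* The energy equals s a n and cancels the part of the gain carrying the factor [a]; the extra 1 in
   [c] leaves s n. The loss [eps] is covered by the spare s, since eps < 1 <= s. *)
have inner : s%:R * n <= (a + 1) * (s%:R * (n + 1) - eps) - s%:R * (mu ^+ 2 * m / 2).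
  rewrite -aE; have : (a + 1) * (s%:R * n) <= (a + 1) * (s%:R * (n + 1) - eps).
    by rewrite ler_wpM2l ?addr_ge0//; lra.
  lra.
have main : k%:R * s%:R * n <= 4 * (n + 1) * eps * expR a.
  have ea : expR (- (a + 1)) * expR a = expR (- 1).
    by rewrite -expRD; congr expR; ring.
  have : k%:R * (expR (- (a + 1)) * (s%:R * n)) <= (n + 1) * eps.
    apply: le_trans bound; rewrite ler_wpM2l// ler_wpM2l ?expR_ge0//.
  rewrite -(ler_pM2r (expR_gt0 a)).
  have -> : k%:R * (expR (- (a + 1)) * (s%:R * n)) * expR a =
    k%:R * s%:R * n * expR (- 1) by rewrite -ea; ring.
  have ksn : 0 <= k%:R * s%:R * n by rewrite !mulr_ge0// ltW.
  have := ler_wpM2l ksn (expRN1_ge R); lra.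
(* The constant 8 leaves room: 4 (n + 1) <= 8 (N + 1), because n = N - k. *)
have prod_le : k%:R * (n / (N + 1)) * (s%:R / (8 * eps)) <= expR a.
  have -> : k%:R * (n / (N + 1)) * (s%:R / (8 * eps)) =
      (k%:R * s%:R * n) / (8 * (N + 1) * eps).
    by field; rewrite !gt_eqF.
  rewrite ler_pdivrMr ?mulr_gt0//; apply: le_trans main _.
  rewrite [leRHS]mulrC ler_wpM2r ?expR_ge0// ler_wpM2r ?(ltW eps0)// /n; lra.
have ln_le : ln k%:R + ln (n / (N + 1)) + ln (s%:R / (8 * eps)) <= a.
  have k0' : 0 < k%:R :> R by exact: lt_le_trans k0.
  have s0' : 0 < s%:R :> R by exact: lt_le_trans s0.
  have nN : 0 < n / (N + 1) by exact: divr_gt0.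
  have seps : 0 < s%:R / (8 * eps) by rewrite divr_gt0// mulr_gt0.
  rewrite -lnM ?posrE// -lnM ?posrE//; last exact: mulr_gt0.
  have P0 := mulr_gt0 (mulr_gt0 k0' nN) seps.
  by rewrite -[leRHS]expRK ler_ln// posrE ?expR_gt0.
have muE : Num.sqrt (mu ^+ 2) = mu by rewrite sqrtr_sqr gtr0_norm.
(* Monotonicity of [Num.sqrt] also covers a negative radicand, whose root is 0 by convention, so the
   void case needs no separate treatment. *)
rewrite -[X in _ <= X]muE; apply: ler_wsqrtr.
apply: (@le_trans _ _ (2 * n / m * a)).
  by rewrite ler_wpM2l// divr_ge0 ?mulr_ge0// ltW.
by rewrite /a le_eqVlt; apply/orP; left; apply/eqP; field; rewrite !gt_eqF.
Qed.
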